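(* Assume that the offspring distribution $\mathcal{Q}$ has finite $\alpha$th moment for some integer $\alpha\ge 2$, and that $d\ge 3$. Then, conditional on $G_n$, $$V_n=O_P(n^{1/\alpha}).$$ In particular, if $\mathcal{Q}$ has finite moments of all orders, then, conditional on $G_n$, $V_n=o_P(n^{\varepsilon})$ for all $\varepsilon>0$.
   Context: Branching random walk: a nearest neighbor branching random walk on $\mathbb{Z}^d$ with offspring distribution $\mathcal{Q}=\{Q_l\}_{l\ge 0}$ evolves as follows: at each time $n=0,1,2,\dots$ every particle independently produces a random number of offspring with law $\mathcal{Q}$ (which replace it), and each offspring independently moves to a site chosen uniformly at random from the $2d+1$ sites at distance $\le 1$ from the location of its parent. Standing assumptions: $\mathcal{Q}$ has mean $1$ (criticality) and finite, positive variance $\sigma^2$; the process is started by a single particle at the origin at time $0$. Notation: $U_n(x)$ is the number of particles at site $x$ in generation $n$; $V_n=\max_{x\in\mathbb{Z}^d}U_n(x)$; $G_n$ is the event that the process survives to generation $n$ (at least one particle in generation $n$). For random variables $X_n$, positive reals $f(n)$ and events $H_n$ of positive probability: $X_n=O_P(f(n))$ given $H_n$ means that the conditional distributions of $X_n/f(n)$ given $H_n$ are tight; $X_n=o_P(f(n))$ given $H_n$ means that the conditional distributions of $X_n/f(n)$ given $H_n$ converge weakly to the point mass at $0$. *)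

(* Defs.v *)
From HB Require Import structures.
From mathcomp Require Import all_boot all_order all_algebra.
From mathcomp Require Import finmap.
From mathcomp Require Import all_classical all_reals all_analysis.
Set Implicit Arguments.
Unset Strict Implicit.
Unset Printing Implicit Defensive.
Import Order.TTheory GRing.Theory Num.Theory numFieldNormedType.Exports.
Local Open Scope classical_set_scope.
Local Open Scope ring_scope.

Section conditional_asymptotics.
Context (d : measure_display) (T : measurableType d) (R : realType).
Implicit Types (P : probability T R) (H : set T) (X : T -> R).

(** Conditional distribution of [X] given [H]: [B |-> P (X \in B | H)].  It is a
    probability measure on [R] when [X] and [H] are measurable and [0 < P H]. *)
Definition cond_distribution P H X (B : set R) : \bar R :=
  (((fine (P H))^-1)%:E * P (X @^-1` B `&` H))%E.

(** Sequences are indexed by [n >= 1], where the normalisations used below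
    ([n `^ a] with [a > 0]) are positive. *)
Definition tight (mu : nat -> set R -> \bar R) : Prop :=
  forall e : R, 0 < e ->
  exists2 K : set R, compact K &
    forall n, (0 < n)%N -> (mu n (~` K) <= e%:E)%E.

Definition cvg_weakly (mu : nat -> set R -> \bar R) (nu : set R -> \bar R)
    : Prop :=
  forall f : R -> R, continuous f -> (exists M, forall x, `|f x| <= M) ->
  (\int[mu n]_x (f x)%:E)%E @[n --> \oo] --> (\int[nu]_x (f x)%:E)%E.

Definition bigO_P P (X : nat -> T -> R) (f : nat -> R) (H : nat -> set T)
    : Prop :=
  tight (fun n => cond_distribution P (H n) (fun w => X n w / f n)).

Definition littleo_P P (X : nat -> T -> R) (f : nat -> R) (H : nat -> set T)
    : Prop :=
  cvg_weakly (fun n => cond_distribution P (H n) (fun w => X n w / f n))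
             (@dirac _ R 0 R).

Definition independent_events P (I : choiceType) (A : I -> set T) : Prop :=
  forall J : {fset I},
    P (\bigcap_(i in [set` J]) A i) = (\prod_(i <- J) P (A i))%E.

End conditional_asymptotics.

(** Particles carry Ulam--Harris labels, most recent ancestor first: [[::]] is
    the initial particle and [i :: u] is the child number [i] of [u]. *)
Definition label := seq nat.

(** Labels of the particles of generation [n], where [k u] is the number of
    offspring of [u]. *)
Fixpoint generation (k : label -> nat) (n : nat) : seq label :=
  if n is m.+1 then [seq i :: u | u <- generation k m, i <- iota 0 (k u)]
  else [:: [::]].

Fixpoint position (d : nat) (s : label -> 'rV[int]_d) (u : label) : 'rV[int]_d :=
  if u is _ :: v then position s v + s u else 0.

Section branching_random_walk.
Context (dT : measure_display) (T : measurableType dT) (R : realType).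
Variables (d : nat) (xi : label -> T -> nat) (step : label -> T -> 'rV[int]_d).

(** [xi u] is the number of offspring of [u] and [step u] the displacement of
    [u] from its parent ([step [::]] plays no role).  Both take values in
    countable discrete spaces, so the events [xi u \in B] and [step u \in C],
    with [B] and [C] arbitrary, make up the sigma-algebras they generate. *)
Record brw_driver (P : probability T R) (Q : probability nat R) : Prop := {
  brw_measurable_xi : forall u B, measurable (xi u @^-1` B);
  brw_measurable_step : forall u C, measurable (step u @^-1` C);
  brw_law_xi : forall u B, P (xi u @^-1` B) = Q B;
  brw_law_step : forall u (z : 'rV[int]_d),
    P (step u @^-1` [set z]) =
    if (\sum_(i < d) `|z ord0 i| <= 1)%N then ((2 * d + 1)%:R^-1)%:E else 0%E;
  brw_independent : forall (B : label -> set nat) (C : label -> set 'rV[int]_d),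
    independent_events P (fun i : label + label =>
      match i with
      | inl u => xi u @^-1` B u
      | inr u => step u @^-1` C u
      end)
}.

Definition U (n : nat) (x : 'rV[int]_d) (w : T) : nat :=
  count (fun u => position (step^~ w) u == x) (generation (xi^~ w) n).

Definition V (n : nat) (w : T) : R := sup (range (fun x => (U n x w)%:R)).

Definition survival (n : nat) : set T :=
  [set w | generation (xi^~ w) n != [::]].

(** The supremum defining [V] is a maximum. *)
Lemma V_max n w : exists2 x, V n w = (U n x w)%:R &
  forall y, (U n y w <= U n x w)%N.
Proof.
pose p k := `[< exists x, U n x w = k >].
have exp : exists k, p k by exists (U n 0 w); apply/asboolP; exists 0.
have bnd k : p k -> (k <= size (generation (xi^~ w) n))%N.
  by move=> /asboolP[x <-]; exact: count_size.
case: (ex_maxnP exp bnd) => k /asboolP[x Ux] maxk.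
have le_y y : (U n y w <= U n x w)%N.
  by rewrite Ux; apply: maxk; apply/asboolP; exists y.
exists x => //; apply/eqP; rewrite eq_le; apply/andP; split.
- by apply: ge_sup => [|_ [y _ <-]]; [exists (U n x w)%:R, x | rewrite ler_nat].
- apply: ub_le_sup; last by exists x.
  by exists (U n x w)%:R => _ [y _ <-]; rewrite ler_nat.
Qed.

End branching_random_walk.
Arguments V {dT T} R {d} xi step n w.

(* Main.v *)
Require Import Defs.
From HB Require Import structures.
From mathcomp Require Import all_boot all_order all_algebra.
From mathcomp Require Import finmap ring lra zify.
From mathcomp Require Import all_classical all_reals all_analysis measurable_realfun.
Set Implicit Arguments.
Unset Strict Implicit.
Unset Printing Implicit Defensive.
Import Order.TTheory GRing.Theory Num.Theory numFieldNormedType.Exports.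
Local Open Scope classical_set_scope.
Local Open Scope ring_scope.

(** Let [p_n] be the [n]-step law of the walk.  The heart of the proof is the bound
    [E U_n(x)^k <= C p_n(x)], by induction on [k] and then on [n].  Splitting over the
    offspring of the initial particle, [U_(n+1)(x)] is a random sum of independent
    terms distributed as [U_n(x - e)] with [e] a uniform step.  Expanding the [k]-th
    power, the pure powers contribute the average of [E U_n(x - e)^k], and every other
    term is a product of at least two lower moments taken at the same site, hence at
    most [C p_(n+1)(x) sup p_(n+1)].  In dimension [d >= 3] the series [sup p_n]
    converges, because [x |-> (|x|^2 + 1024)^(-1/4)] is superharmonic (strictly so at
    the origin).  Thus [sum_x E U_n(x)^alpha] is bounded, and since a second moment
    estimate gives [P(G_n) >= 1 / (c n)], Markov's inequality yields
    [P(V_n > t n^(1/alpha) | G_n) <= C / t^alpha]. *)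

(** * The walk *)

(** The comparison is with [p_n(x)] itself because criticality already gives it for the first
    moment. A cross term is of order [p_(n+1)(x)^2], and trading one factor for its supremum is what
    lets the induction on [n] close. A local limit theorem for these suprema is avoided: by symmetry
    and Cauchy-Schwarz, the walk at an even time is most likely to be at its starting point, so it
    suffices that the expected number of returns is finite, and this follows from the superharmonic
    function by telescoping. The offspring number enters the bound for order [k] only through [N]
    and [N^k], which is why the moment of order [alpha] suffices. Removing the initial particle
    replaces the process by the processes of its children, so every bound is stated for all drivers
    at once; independence of whole subtrees has to be extracted from that of finitely many
    coordinate events. The same recursion, run in dimension 0 with all suprema equal to 1, gives the
    linear growth of the second moment of the population. *)

Section counting.
Variable T : eqType.

Lemma count_mem_sum (x : T) s : count_mem x s = (\sum_(y <- s) (y == x))%N.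
Proof. by rewrite -sum1_count big_mkcond; apply: eq_bigr => y _ /=; case: eqP. Qed.

Lemma sum_eq_uniq (s : seq T) (y : T) : uniq s ->
  (\sum_(x <- s) (y == x) = (y \in s))%N.
Proof.
move=> us; rewrite -count_uniq_mem// count_mem_sum.
by apply: eq_bigr => x _; rewrite eq_sym.
Qed.

(** Cauchy--Schwarz for the multiplicities of the values in the two lists. *)
Lemma collision_le (A B : seq T) :
  (2 * (\sum_(a <- A) \sum_(b <- B) (a == b)) <=
   \sum_(a <- A) \sum_(a' <- A) (a == a') +
   \sum_(b <- B) \sum_(b' <- B) (b == b'))%N.
Proof.
pose s := undup (A ++ B).
have us : uniq s by exact: undup_uniq.
have E (C D : seq T) : {subset C <= s} ->
    (\sum_(a <- C) \sum_(b <- D) (a == b) =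
     \sum_(y <- s) count_mem y C * count_mem y D)%N.
  move=> sC; under [in RHS]eq_bigr do rewrite [X in (X * _)%N]count_mem_sum big_distrl/=.
  rewrite [RHS]exchange_big/=; apply: eq_big_seq => a /sC as'.
  rewrite [RHS](bigD1_seq a)//= eqxx mul1n [X in (_ + X)%N]big1_seq ?addn0; last first.
    by move=> y /andP[ya _]; rewrite eq_sym (negPf ya).
  by rewrite count_mem_sum; apply: eq_bigr => b _; rewrite eq_sym.
have sA : {subset A <= s} by move=> x; rewrite mem_undup mem_cat => ->.
have sB : {subset B <= s} by move=> x; rewrite mem_undup mem_cat orbC => ->.
rewrite !E// big_distrr -big_split/=; apply: leq_sum => y _.
exact: nat_Cauchy.
Qed.

End counting.

Section walk.
Variables (R : rcfType) (V : zmodType) (E : seq V).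

(** End points of the [n]-step paths, listed with multiplicity. *)
Fixpoint walk (n : nat) : seq V :=
  if n is m.+1 then [seq y + e | y <- walk m, e <- E] else [:: 0].

Definition walk_law (n : nat) (x : V) : R :=
  (count_mem x (walk n))%:R / (size E)%:R ^+ n.

Lemma size_walk n : size (walk n) = (size E ^ n)%N.
Proof. by elim: n => // n IH; rewrite /= size_allpairs IH expnSr. Qed.

Lemma walk_law0 x : walk_law 0 x = (x == 0)%:R.
Proof. by rewrite /walk_law /= addn0 expr0 divr1 eq_sym. Qed.

Lemma walk_law_ge0 n x : 0 <= walk_law n x.
Proof. by rewrite divr_ge0// exprn_ge0. Qed.

Hypothesis E0 : (0 < size E)%N.

Let K0 n : 0 < (size E)%:R ^+ n :> R.
Proof. by rewrite exprn_gt0// ltr0n. Qed.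

Lemma sum_walk_law_le1 n (s : seq V) : uniq s -> \sum_(x <- s) walk_law n x <= 1.
Proof.
move=> us; rewrite -mulr_suml ler_pdivrMr// mul1r -natrX -size_walk -natr_sum ler_nat.
under eq_bigr do rewrite count_mem_sum.
rewrite exchange_big/= -sum1_size leq_sum// => y _.
by rewrite sum_eq_uniq//; case: (_ \in _).
Qed.

Lemma walk_law_le1 n x : walk_law n x <= 1.
Proof. by have := @sum_walk_law_le1 n [:: x] isT; rewrite big_seq1. Qed.

Lemma walk_lawD n m x :
  walk_law (n + m) x = (\sum_(y <- walk m) walk_law n (x - y)) / (size E)%:R ^+ m.
Proof.
have E1 (y z e : V) : (y + e == z) = (y == z - e) :> bool by rewrite -subr_eq opprK.
have E2 : forall z, (count_mem z (walk (n + m)) =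
    \sum_(y <- walk m) count_mem (z - y)%R (walk n))%N.
  elim: m => [|m IH] z; first by rewrite addn0 /= big_seq1 subr0.
  rewrite addnS /= count_mem_sum !big_allpairs_dep/= exchange_big/=.
  rewrite [RHS]exchange_big/=; apply: eq_bigr => e _.
  under [RHS]eq_bigr do rewrite (addrC _ e) opprD addrA.
  rewrite -IH count_mem_sum; apply: eq_bigr => y _; by rewrite E1.
rewrite /walk_law E2 natr_sum -!mulr_suml exprD invfM mulrA; congr (_ * _ * _).
Qed.

Lemma walk_lawS n x :
  walk_law n.+1 x = (\sum_(e <- E) walk_law n (x - e)) / (size E)%:R.
Proof.
rewrite -addn1 walk_lawD /= expr1; congr (_ / _).
by rewrite cats0 big_map; under eq_bigr do rewrite add0r.
Qed.

Hypothesis Esym : perm_eq E (map -%R E).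

Lemma walk_lawN n x : walk_law n (- x) = walk_law n x.
Proof.
elim: n x => [|n IH] x; first by rewrite !walk_law0 oppr_eq0.
rewrite !walk_lawS (perm_big _ Esym)/= big_map; congr (_ / _).
by apply: eq_bigr => e _; rewrite -opprD IH.
Qed.

(** Both sides count coincidences between two lists of end points of [n]-step paths. Reflecting one
    list through [x] keeps its number of self-coincidences, so [collision_le] applies and symmetry
    identifies the result with returns to 0. *)
Lemma walk_law_le_return n x : walk_law (n + n) x <= walk_law (n + n) 0.
Proof.
rewrite !walk_lawD ler_pM2r ?invr_gt0//.
under [leRHS]eq_bigr do rewrite sub0r walk_lawN.
rewrite /walk_law -!mulr_suml ler_pM2r ?invr_gt0// -!natr_sum ler_nat.
pose A := [seq x - y | y <- walk n].
have := collision_le A (walk n).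
have -> : (\sum_(a <- A) \sum_(a' <- A) (a == a') =
           \sum_(y <- walk n) \sum_(y' <- walk n) (y == y'))%N.
  rewrite big_map; apply: eq_bigr => y _; rewrite big_map; apply: eq_bigr => y' _.
  by rewrite (inj_eq (addrI _)) eqr_opp.
have E1 (f : V -> V) : (\sum_(y <- walk n) count_mem (f y) (walk n) =
    \sum_(y <- walk n) \sum_(z <- walk n) (f y == z))%N.
  apply: eq_bigr => y _; rewrite count_mem_sum.
  by apply: eq_bigr => z _; rewrite eq_sym.
by rewrite addnn -mul2n leq_pmul2l// big_map (E1 (fun y => x - y)) (E1 id).
Qed.

(** Along the walk the mean of [f] decreases by at least [k * walk_law j 0] at
    step [j]. *)
Lemma green_le (f : V -> R) (k : R) (n : nat) : (forall x, 0 <= f x) ->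
  (forall x, (\sum_(e <- E) f (x + e)) / (size E)%:R + k * (x == 0)%:R <= f x) ->
  k * (\sum_(j < n) walk_law j 0) <= f 0.
Proof.
move=> f0 sup.
suff H : k * (\sum_(j < n) walk_law j 0) +
    (\sum_(y <- walk n) f y) / (size E)%:R ^+ n <= f 0.
  apply: le_trans H; rewrite lerDl divr_ge0 ?(ltW (K0 _))//.
  by apply: sumr_ge0.
elim: n => [|n IH]; first by rewrite big_ord0 mulr0 add0r /= big_seq1 expr0 divr1.
apply: le_trans IH; rewrite big_ord_recr/= mulrDr -addrA lerD2l.
rewrite big_allpairs_dep/= exprS invfM mulrA /walk_law mulrA -mulrDl.
rewrite ler_pM2r ?invr_gt0// count_mem_sum natr_sum mulr_sumr mulr_suml.
by rewrite -big_split/= ler_sum// => y _; rewrite addrC.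
Qed.

End walk.

(** * Estimates for the power -1/4 *)

Section inverse_fourth_root.
Variable R : rcfType.
Implicit Types u y z : R.

(** Square roots exist in every real closed field, and for [u > 0] the fourth power is [u^-1], so
    inequalities become polynomial after raising to the fourth power. The exponent 1/4 lies below
    [(d - 2) / 2] for every [d >= 3]. *)
Definition invroot4 u : R := (Num.sqrt (Num.sqrt u))^-1.

Lemma invroot4_gt0 u : 0 < u -> 0 < invroot4 u.
Proof. by move=> u0; rewrite invr_gt0 !sqrtr_gt0. Qed.

Lemma invroot4K u : 0 < u -> invroot4 u ^+ 4 = u^-1.
Proof.
move=> u0; rewrite exprVn (_ : 4 = 2 * 2)%N// exprM !sqr_sqrtr ?sqrtr_ge0//.
exact: ltW.
Qed.

(** The Taylor coefficient of [z^2] is 10/64; the additional 1/64 absorbs the remainder when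
    [|z| <= 1/32]. *)
Lemma invroot4_taylor_le u z : 0 < u -> `|z| <= 32^-1 ->
  invroot4 (u * (1 + z)) <= invroot4 u * (1 - z / 4 + 11 / 64 * z ^+ 2).
Proof.
rewrite ler_norml => u0 /andP[z1 z2].
have q0 : 0 < 1 - z / 4 + 11 / 64 * z ^+ 2 by nra.
have z0 : 0 < 1 + z by lra.
rewrite -(@ler_pXn2r _ 4) ?nnegrE//; last 2 first.
- by rewrite ltW// invroot4_gt0 ?mulr_gt0.
- by rewrite ltW// mulr_gt0// invroot4_gt0.
rewrite exprMn !invroot4K ?mulr_gt0// invfM ler_pM2l ?invr_gt0//.
rewrite -[leLHS]mul1r ler_pdivrMr//.
pose t := z / 4; pose v := 1 - 11 / 4 * t.
have t1 : `|t| <= 128^-1 by rewrite ler_norml; apply/andP; split; rewrite /t; lra.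
have v0 : 0 <= v by rewrite /v /t; lra.
have v1 : v <= 9 / 8 by rewrite /v /t; lra.
have -> : 1 - z / 4 + 11 / 64 * z ^+ 2 = 1 - t * v by rewrite /v /t; field.
have -> : 1 + z = 1 + 4 * t by rewrite /t; field.
(* The remainder is gathered in [t * (11 + g)]. As [|t| <= 1/128], the bound [|11 + g| <= 128] keeps
   it above -1, so the factor of [t ^+ 2] is nonnegative. *)
pose g := 24 * v ^+ 2 - 4 * v ^+ 3 + t * (v ^+ 4 - 16 * v ^+ 3)
  + t * (t * (4 * v ^+ 4)).
have -> : (1 - t * v) ^+ 4 * (1 + 4 * t) = 1 + t ^+ 2 * (1 + 6 * (1 - v) ^+ 2 + t * (11 + g)).
  by rewrite /g /v; field.
have tM (w : R) : `|w| <= 128 -> `|t * w| <= 1.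
  by move=> w1; have -> : 1 = 128^-1 * 128 :> R by [field]; rewrite normrM ler_pM.
have nE (a b : R) : - b <= a <= b -> `|a| <= b by rewrite ler_norml.
have v2 : v ^+ 2 <= 2 by nra.
have v3 : v ^+ 3 <= 2 by rewrite exprS; nra.
have v20 := sqr_ge0 v; have v30 : 0 <= v ^+ 3 by rewrite exprn_ge0.
have v4 : 0 <= v ^+ 4 <= 4 by rewrite exprn_ge0//= (exprM v 2 2); nra.
have /tM : `|11 + g| <= 128.
  have /tM : `|v ^+ 4 - 16 * v ^+ 3| <= 128 by apply: nE; lra.
  have /tM h2 : `|t * (4 * v ^+ 4)| <= 128.
    by apply: (@le_trans _ _ 1); [apply: tM; apply: nE|]; lra.
  move: h2; rewrite !ler_norml => h2 h1; rewrite /g; lra.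
rewrite ler_norml => /andP[h1 _]; rewrite lerDl mulr_ge0 ?sqr_ge0//.
have := sqr_ge0 (1 - v); lra.
Qed.

(** The convex function [y |-> (1 - y)^(-1/4)] lies above its tangent at 0; here [y = 1/u]. *)
Lemma invroot4_pred_ge u : 1 < u ->
  invroot4 u * (1 + (4 * u)^-1) <= invroot4 (u - 1).
Proof.
move=> u1; have u0 : 0 < u by lra.
have v0 : 0 < u - 1 by lra.
rewrite -(@ler_pXn2r _ 4) ?nnegrE//; last 2 first.
- by rewrite ltW// mulr_gt0 ?invroot4_gt0// addr_gt0// invr_gt0 mulr_gt0.
- by rewrite ltW// invroot4_gt0.
rewrite exprMn !invroot4K//.
have -> : (u - 1)^-1 = u^-1 * (1 - u^-1)^-1 by field; rewrite !gt_eqF.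
rewrite ler_pM2l ?invr_gt0// invfM; set y := u^-1.
have y0 : 0 < y by rewrite invr_gt0.
have y1 : y < 1 by rewrite invf_lt1.
rewrite -[leRHS]mul1r ler_pdivlMr ?subr_gt0//.
rewrite -subr_ge0.
have -> : 1 - (1 + 4^-1 * y) ^+ 4 * (1 - y) =
  y ^+ 2 * ((1 - (1 - y)) + (1 - y) * (1 - (3 / 8 + y / 16 + y ^+ 2 / 256))) by field.
apply: mulr_ge0; first nra.
apply: addr_ge0; first lra.
apply: mulr_ge0; first lra.
nra.
Qed.

End inverse_fourth_root.

(** * Transience in dimension at least 3 *)

Section unit_steps.
Variable d : nat.
Implicit Types x y : 'rV[int]_d.

Definition unit_steps : seq 'rV[int]_d :=
  0 :: [seq delta_mx 0 i | i <- enum 'I_d] ++ [seq - delta_mx 0 i | i <- enum 'I_d].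

Lemma size_unit_steps : size unit_steps = (2 * d + 1)%N.
Proof. by rewrite /= size_cat !size_map -enumT size_enum_ord addnn mul2n addn1. Qed.

Lemma size_unit_steps_gt0 : (0 < size unit_steps)%N.
Proof. by []. Qed.

Lemma unit_stepsN : perm_eq unit_steps (map -%R unit_steps).
Proof.
rewrite /unit_steps map_cons oppr0 perm_cons map_cat -!map_comp.
rewrite perm_catC perm_cat//; set s := map _ _; set t := map _ _.
suff -> : t = s by [].
by apply: eq_map => i /=; rewrite opprK.
Qed.

Lemma sum_unit_steps (A : nmodType) (F : 'rV[int]_d -> A) :
  \sum_(e <- unit_steps) F e =
  F 0 + \sum_(i < d) (F (delta_mx 0 i) + F (- delta_mx 0 i)).
Proof.
by rewrite big_cons big_cat !big_map -!enumT !big_enum big_split.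
Qed.

Lemma mem_unit_steps x : (\sum_(i < d) `|x ord0 i| <= 1)%N -> x \in unit_steps.
Proof.
move=> x1; have [->|x0] := eqVneq x 0; first by rewrite inE eqxx.
have [i xi] : exists i, x ord0 i != 0.
  apply/existsP; apply: contra_neqT x0 => /existsPn x0.
  by apply/matrixP => i j; rewrite ord1 mxE; apply/eqP; have := x0 j; rewrite negbK.
have xj j : j != i -> x ord0 j = 0.
  move=> ji; move: x1; rewrite (bigD1 i)//= (bigD1 j)//= => x1.
  have : (0 < `|x ord0 i|)%N by rewrite absz_gt0.
  by move: x1; case: (x ord0 j) => [[|n]|n] //=; lia.
have : x ord0 i = 1 \/ x ord0 i = -1.
  by move: x1; rewrite (bigD1 i)//=; move: xi; lia.
have E (a : int) : x ord0 i = a -> x = a *: delta_mx 0 i.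
  move=> xa; apply/matrixP => k j; rewrite ord1 !mxE eqxx/=.
  by have [->|/xj ->] := eqVneq j i; rewrite ?xa ?mulr1 ?mulr0.
rewrite inE mem_cat => -[] /E ->.
- by rewrite scale1r map_f ?orbT// mem_enum.
- by rewrite scaleN1r (map_f (fun i => - delta_mx 0 i)) ?orbT// mem_enum.
Qed.

Variable R : rcfType.

Let sqnorm x : R := \sum_(i < d) (x ord0 i)%:~R ^+ 2.

Let sqnormD1 x i (s : R) (e : 'rV[int]_d) : (forall j, (e ord0 j)%:~R = s *+ (j == i)) ->
  s ^+ 2 = 1 -> sqnorm (x + e) = sqnorm x + 1 + 2 * s * (x ord0 i)%:~R.
Proof.
move=> es s1; rewrite /sqnorm (bigD1 i)//= [in RHS](bigD1 i)//= mxE intrD es eqxx.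
under eq_bigr => j /negPf ji do rewrite mxE intrD es ji addr0.
rewrite mulr1n sqrrD s1 -mulr_natl; ring.
Qed.

Let sqnorm_ge0 x : 0 <= sqnorm x.
Proof. by apply: sumr_ge0 => i _; exact: sqr_ge0. Qed.

Let pot x : R := invroot4 (sqnorm x + 1024).

Let pot_gt0 x : 0 < pot x.
Proof. by apply: invroot4_gt0; have := sqnorm_ge0 x; lra. Qed.

(** [(|x|^2 + c)^(-s)] works whenever [0 < s < (d - 2) / 2] and [c] is large; the
    value [c = 1024] brings the relative increments of [|x|^2 + c + 1] within the range
    of [invroot4_taylor_le]. *)
Lemma exists_superharmonic : (3 <= d)%N -> exists2 f : 'rV[int]_d -> R,
  (forall x, 0 <= f x) & exists2 k, 0 < k &
  forall x, (\sum_(e <- unit_steps) f (x + e)) / (size unit_steps)%:R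
     + k * (x == 0)%:R <= f x.
Proof.
move=> d3; exists pot.
  by move=> x; exact/ltW/pot_gt0.
(* [1025 = 1024 + 1]: with [u = |x|^2 + 1025], a step along axis [i] turns [|x|^2 + 1024] into
   [u + 2 x_i] or [u - 2 x_i], so the expansion is centred at [u], while [pot x] is the value at
   [u - 1]. *)
have [v vE] : exists v : R, v = 1025 by exists 1025.
have v0 : 0 < v by lra.
(* The surplus [u^(-1/4) / (8 u)] obtained below holds at every [x]; this is its value at the
   origin, where [u = v], divided by the number of steps. *)
exists (invroot4 v / (8 * v) / (size unit_steps)%:R).
  by rewrite !divr_gt0 ?mulr_gt0 ?invroot4_gt0// ltr0n.
move=> x; set r := sqnorm x; set u := r + v.
have r0 : 0 <= r by apply: sumr_ge0 => i _; exact: sqr_ge0.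
have u0 : 0 < u by rewrite /u vE; lra.
have u1 : 1 < u by rewrite /u vE; lra.
have h0 := invroot4_gt0 u0.
rewrite size_unit_steps; set K : R := (2 * d + 1)%:R.
have KE : K = 2 * d%:R + 1 by rewrite /K natrD natrM.
have K0 : 0 < K by rewrite KE ltr_wpDl.
suff H : \sum_(e <- unit_steps) pot (x + e) + invroot4 u / (8 * u) <= K * pot x.
  rewrite mulrAC -mulrDl ler_pdivrMr// [leRHS]mulrC; apply: le_trans H; rewrite lerD2l.
  have [x0|_] := eqVneq x 0; last by rewrite mulr0 divr_ge0 ?ltW ?mulr_gt0.
  have uE : u = v.
    by rewrite /u /r /sqnorm x0 big1 ?add0r// => i _; rewrite mxE expr0n.
  by rewrite mulr1 uE.
have step i : pot (x + delta_mx 0 i) + pot (x - delta_mx 0 i) <=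
    invroot4 u * (2 + 11 / 8 * (x ord0 i)%:~R ^+ 2 / u ^+ 2).
  set a : R := (_)%:~R.
  (* From [a^2 + 32^2 >= 64 |a|], where [32^2 = 1024]. *)
  have au : `|2 * a / u| <= 32^-1.
    rewrite normrM normfV (gtr0_norm u0) ler_pdivrMr// ler_norml.
    have : a ^+ 2 <= r.
      by rewrite /r /sqnorm (bigD1 i)//= lerDl sumr_ge0// => j _; exact: sqr_ge0.
    have := sqr_ge0 (a - 32); have := sqr_ge0 (a + 32); rewrite !expr2 /u vE => ? ? ?.
    by apply/andP; split; lra.
  have uK : u * (2 * a / u) = 2 * a by rewrite mulrC divfK// gt_eqF.
  have -> : pot (x + delta_mx 0 i) = invroot4 (u * (1 + 2 * a / u)).
    rewrite /pot (@sqnormD1 _ i 1) ?expr1n//; last first.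
      by move=> j; rewrite mxE eqxx/=; case: (j == i).
    by congr invroot4; rewrite -/r -/a mulrDr mulr1 ?mulrN uK /u vE; ring.
  have -> : pot (x - delta_mx 0 i) = invroot4 (u * (1 + - (2 * a / u))).
    rewrite /pot (@sqnormD1 _ i (-1)) ?sqrrN ?expr1n//; last first.
      by move=> j; rewrite !mxE eqxx/=; case: (j == i); rewrite ?mulr1n ?mulr0n ?oppr0.
    by congr invroot4; rewrite -/r -/a mulrDr mulr1 ?mulrN uK /u vE; ring.
  have H1 := invroot4_taylor_le u0 au.
  have au' : `|- (2 * a / u)| <= 32^-1 by rewrite normrN.
  have H2 := invroot4_taylor_le u0 au'.
  apply: le_trans (lerD H1 H2) _; rewrite -mulrDr ler_pM2l// sqrrN.
  by rewrite le_eqVlt; apply/orP; left; apply/eqP; field; rewrite gt_eqF.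
have Hpred : invroot4 u * (1 + (4 * u)^-1) <= pot x.
  apply: le_trans (invroot4_pred_ge u1) _.
  by rewrite /pot -/r /u (_ : _ - 1 = r + 1024)// vE; ring.
rewrite sum_unit_steps addr0 KE [leRHS]mulrDl mul1r -addrA [leRHS]addrC lerD2l.
rewrite addrC.
apply: (@le_trans _ _ (2 * d%:R * (invroot4 u * (1 + (4 * u)^-1)))); last first.
  by rewrite ler_wpM2l ?mulr_ge0.
apply: (@le_trans _ _ (invroot4 u / (8 * u) + \sum_(i < d)
    invroot4 u * (2 + 11 / 8 * (x ord0 i)%:~R ^+ 2 / u ^+ 2))).
  by rewrite lerD2l ler_sum.
rewrite -mulr_sumr big_split/= sumr_const card_ord -mulr_suml -mulr_sumr -/r.
rewrite [leRHS]mulrCA -mulrDr ler_pM2l// -[2 *+ d]mulr_natr.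
(* Up to the factor [u^(-1/4)], the second-order terms cost at most [11 / (8 u)] and the surplus
   [1 / (8 u)], while the passage from [u] to [u - 1] gains [d / (2 u)]. The costs add up to exactly
   [3 / (2 u)]. *)
have d3R : 3 <= d%:R :> R by rewrite ler_nat.
have ru : r / u ^+ 2 <= u^-1.
  by rewrite ler_pdivrMr ?exprn_gt0// expr2 mulKf ?gt_eqF// /u vE; lra.
have iu : 0 < u^-1 by rewrite invr_gt0.
rewrite !invfM -[\sum_(i < d) _]/r -(mulrA (11 / 8)).
have hd := ler_wpM2r (ltW iu) d3R.
nra.
Qed.

(** The return bound covers even times; one further step averages and cannot raise the supremum.
    Hence [s n] is the return probability at the largest even time up to [n], and each even return
    probability is counted at most twice. *)
Lemma unit_walk_sup_summable : (3 <= d)%N -> exists2 s : nat -> R,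
  (forall n, s n <= 1) /\ (forall n x, walk_law R unit_steps n x <= s n) &
  exists G, forall n, \sum_(j < n) s j <= G.
Proof.
move=> /exists_superharmonic[f f0 [k k0 fk]].
pose p n := walk_law R unit_steps n 0.
pose s n := p (n./2 + n./2)%N.
have sle n x : walk_law R unit_steps n x <= s n.
  have H m y := walk_law_le_return R size_unit_steps_gt0 unit_stepsN m y.
  rewrite -[n in X in X <= _]odd_double_half -addnn /s.
  case: (odd n); last by rewrite add0n; exact: H.
  rewrite add1n walk_lawS// ler_pdivrMr ?ltr0n//.
  apply: le_trans (ler_sum _ (fun e _ => H _ _)) _.
  by rewrite big_const_seq count_predT iter_addr_0 mulr_natr.
exists s; first by split=> // n; exact: walk_law_le1.
have s0 n : 0 <= s n by exact: walk_law_ge0.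
have s2 m : \sum_(j < m.*2) s j <= 2 * \sum_(j < m.*2) p j.
  elim: m => [|m IH]; first by rewrite !big_ord0 mulr0.
  rewrite doubleS !big_ord_recr/= -!addrA mulrDr lerD// {1 2}/s/= uphalf_double doubleK addnn.
  by rewrite -mulr2n -[leLHS]mulr_natl ler_pM2l// lerDl walk_law_ge0.
exists (2 * (f 0 / k)) => n.
apply: (@le_trans _ _ (\sum_(j < n.*2) s j)).
  by rewrite -addnn big_split_ord/= lerDl sumr_ge0.
apply: le_trans (s2 n) _; rewrite ler_pM2l// ler_pdivlMr// mulrC.
exact: (green_le size_unit_steps_gt0 _ f0).
Qed.

End unit_steps.

(** * Independence and expectations of counting variables *)

Section discretely_measurable.
Variables (T : Type) (G : set (set T)).

(** [A] is meant to carry its discrete structure, and [G] is a parameter so that the same lemmas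
    serve the whole sigma-algebra and those generated by parts of the driver. *)
Definition discretely_measurable (A : Type) (X : T -> A) := forall B, G (X @^-1` B).

Lemma discretely_measurable_comp (A B : Type) (f : A -> B) (X : T -> A) :
  discretely_measurable X -> discretely_measurable (f \o X).
Proof. by move=> mX C; rewrite comp_preimage. Qed.

Hypothesis sG : sigma_algebra setT G.

Let G0 : G set0. Proof. by case: sG. Qed.

Let GC A : G A -> G (~` A).
Proof. by rewrite -setTD; case: sG => _ + _; apply. Qed.

Let GU (F : nat -> set T) : (forall n, G (F n)) -> G (\bigcup_n F n).
Proof. by case: sG => _ _; apply. Qed.

Let GI A B : G A -> G B -> G (A `&` B).
Proof.
move=> GA GB; rewrite -[A `&` B]setCK setCI -bigcup2E; apply/GC/GU.
by case=> [|[|n]] /=; [exact: GC|exact: GC|exact: G0].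
Qed.

Lemma discretely_measurable_cst (A : Type) (a : A) : discretely_measurable (fun=> a).
Proof.
move=> B; have [Ba|Ba] := pselect (B a).
  by rewrite (_ : _ @^-1` _ = ~` set0); [exact: GC|rewrite setC0; apply/seteqP; split].
by rewrite (_ : _ @^-1` _ = set0)//; apply/seteqP; split.
Qed.

Lemma discretely_measurable_mem A : G A -> discretely_measurable (fun w => w \in A).
Proof.
move=> GA B; have [B1|B1] := pselect (B true); have [B0|B0] := pselect (B false).
- rewrite (_ : _ @^-1` _ = ~` set0); first exact: GC.
  by rewrite setC0; apply/seteqP; split=> w //= _; case: (w \in A).
- rewrite (_ : _ @^-1` _ = A)//; apply/seteqP; split=> w /=; last by move=> Aw; rewrite mem_set.
  by have [//|Aw] := pselect (A w); rewrite memNset.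
- rewrite (_ : _ @^-1` _ = ~` A); first exact: GC.
  apply/seteqP; split=> w /=; last by move=> Aw; rewrite memNset.
  by move=> Bw Aw; apply: B1; move: Bw; rewrite mem_set.
- rewrite (_ : _ @^-1` _ = set0)//; apply/seteqP; split=> w //=.
  by case: (w \in A).
Qed.

(** Splitting over the countably many values of [X] freezes a random index, such as a list of labels
    or a displacement. *)
Lemma discretely_measurable_bind (A : countType) (B : Type) (X : T -> A)
    (F : A -> T -> B) : discretely_measurable X ->
  (forall a, discretely_measurable (F a)) -> discretely_measurable (fun w => F (X w) w).
Proof.
move=> mX mF C.
rewrite (_ : _ @^-1` _ = \bigcup_n (if @choice.unpickle A n is Some a then
    X @^-1` [set a] `&` F a @^-1` C else set0)); last first.
  apply/seteqP; split=> [w Cw|w [n _]].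
    by exists (choice.pickle (X w)) => //; rewrite choice.pickleK.
  by case: choice.unpickle => // a [/= ->].
by apply: GU => n; case: choice.unpickle => // a; apply: GI; [exact: mX|exact: mF].
Qed.

Lemma discretely_measurable2 (A B : countType) (C : Type) (f : A -> B -> C)
    (X : T -> A) (Y : T -> B) : discretely_measurable X -> discretely_measurable Y ->
  discretely_measurable (fun w => f (X w) (Y w)).
Proof.
move=> mX mY; apply: (discretely_measurable_bind mX (F := fun a w => f a (Y w))) => a.
exact: (discretely_measurable_comp _ mY).
Qed.

End discretely_measurable.

(** * Independence of disjoint blocks of coordinates *)

Section independence.
Context (dT : measure_display) (T : measurableType dT) (R : realType).
Variables (P : probability T R) (I : choiceType) (C : I -> set (set T)).

(** The pi-system generating the joint sigma-algebra of the coordinates in [S]. *)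
Definition cylinders (S : set I) : set (set T) :=
  [set E | exists2 J : {fset I}, [set` J] `<=` S &
    exists2 A : I -> set T, (forall i, C i (A i)) & E = \bigcap_(i in [set` J]) A i].

Hypothesis mC : forall i, C i `<=` measurable.
Hypothesis CT : forall i, C i setT.
Hypothesis CI : forall i, setI_closed (C i).
Hypothesis indC : forall A : I -> set T, (forall i, C i (A i)) ->
  independent_events P A.

Lemma cylinders_measurable S : cylinders S `<=` measurable.
Proof.
move=> _ [J _ [A CA ->]]; apply: fin_bigcap_measurable => // i _.
exact/mC/CA.
Qed.

Lemma cylindersI S : setI_closed (cylinders S).
Proof.
move=> _ _ [J JS [A CA ->]] [K KS [B CB ->]].
exists (J `|` K)%fset.
  by move=> i /=; rewrite in_fsetU => /orP[/JS|/KS].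
exists (fun i => (if i \in J then A i else setT) `&` (if i \in K then B i else setT)).
  by move=> i; apply: CI; case: ifP.
apply/seteqP; split=> [w [Aw Bw] i _|w ABw].
  by split; case: ifP => // iJ; [exact: Aw|exact: Bw].
by split=> i /= iJ; have := ABw i; rewrite /= in_fsetU iJ ?orbT/= => -[].
Qed.

Lemma cylinders_indep S S' E F : S `&` S' = set0 ->
  cylinders S E -> cylinders S' F -> P (E `&` F) = (P E * P F)%E.
Proof.
move=> SS' [J JS [A CA ->]] [K KS [B CB ->]].
have JK i : i \in J -> i \notin K.
  move=> iJ; apply/negP => iK; suff : (S `&` S') i by rewrite SS'.
  by split; [exact: JS|exact: KS].
pose D i := if i \in J then A i else B i.
have CD i : C i (D i) by rewrite /D; case: ifP.
rewrite (_ : _ `&` _ = \bigcap_(i in [set` (J `|` K)%fset]) D i); last first.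
  apply/seteqP; split=> [w [Aw Bw] i|w Dw].
    rewrite /= in_fsetU /D => iJK; case: ifP => iJ; first exact: Aw.
    by apply: Bw; move: iJK; rewrite iJ.
  split=> i /= iJ; have := Dw i; rewrite /D /= in_fsetU iJ ?orbT/=; first by apply.
  by move=> /(_ isT); case: ifP => // /JK; rewrite iJ.
rewrite !indC// (perm_big (enum_fset J ++ enum_fset K)); last first.
  apply: uniq_perm; rewrite ?fset_uniq// ?cat_uniq ?fset_uniq/= ?andbT.
    by apply/hasPn => i iK; apply/negP => /JK; rewrite iK.
  by move=> i; rewrite in_fsetU mem_cat.
rewrite big_cat/=; congr (_ * _)%E; apply: eq_big_seq => i iJ; rewrite /D ?iJ//.
by case: ifP => // /JK; rewrite iJ.
Qed.

Lemma sigma_cylinders_measurable S : <<s cylinders S >> `<=` measurable.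
Proof.
apply: smallest_sub; first exact: sigma_algebra_measurable.
exact: cylinders_measurable.
Qed.

Let cylindersT S : cylinders S setT.
Proof.
exists fset0; first by move=> i /=; rewrite in_fset0.
by exists (fun=> setT) => //; rewrite bigcapT.
Qed.

(** As functions of [E], both sides are finite measures that agree on a pi-system, hence on the
    sigma-algebra it generates. Used once in each argument, this passes from cylinders to blocks. *)
Let extend S (F : set T) : measurable F ->
  (forall E, cylinders S E -> P (E `&` F) = (P E * P F)%E) ->
  forall E, <<s cylinders S >> E -> P (E `&` F) = (P E * P F)%E.
Proof.
move=> mF EF E sE.
have PF : P F = (fine (P F))%:E by rewrite fineK// fin_num_measure.
have r0 : 0 <= fine (P F) by exact: fine_ge0.
have := @g_sigma_algebra_measure_unique _ R T (cylinders S)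
  (@cylinders_measurable S) (fun=> setT) (fun=> cylindersT S) _
  (mrestr P mF) (mscale (NngNum r0) P) (@cylindersI S) _ _ E sE.
move=> H; rewrite muleC [X in (X * _)%E]PF; apply: H.
- by rewrite bigcup_const//; exists 0%N.
- move=> A cA; rewrite [LHS]EF// muleC [X in (X * _)%E]PF//.
- by move=> _; rewrite ltey_eq fin_num_measure.
Qed.

Lemma sigma_cylinders_indep S S' E F : S `&` S' = set0 ->
  <<s cylinders S >> E -> <<s cylinders S' >> F -> P (E `&` F) = (P E * P F)%E.
Proof.
move=> SS' sE sF; have mF := sigma_cylinders_measurable sF.
apply: (extend mF _ sE) => E' cE'.
rewrite setIC muleC; apply: (extend (cylinders_measurable cE') _ sF) => F' cF'.
by rewrite setIC muleC; exact: cylinders_indep SS' cE' cF'.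
Qed.

Lemma cylinders_subset S S' : S `<=` S' -> cylinders S `<=` cylinders S'.
Proof. by move=> SS' E [J JS H]; exists J => // i /JS /SS'. Qed.

Lemma sub_cylinders S i : S i -> C i `<=` cylinders S.
Proof.
move=> Si E CE; exists [fset i]%fset; first by move=> j /=; rewrite in_fset1 => /eqP ->.
exists (fun j => if pselect (j = i) is left e then E else setT).
  by move=> j; case: pselect => // ->.
apply/seteqP; split=> [w Ew j /=|w /(_ i)]; first by case: pselect.
by rewrite /= in_fset1 eqxx; case: pselect => //= _; apply.
Qed.

End independence.

(** * Moments of variables with values in the natural numbers *)

Section nat_expectation.
Context (dT : measure_display) (T : measurableType dT) (R : realType).
Variable P : probability T R.
Implicit Types X Y : T -> nat.
Local Notation dmeas := (discretely_measurable (@measurable _ T)).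

(** Extended-valued, so that moments can be manipulated before they are known to be finite. *)
Definition natE X : \bar R := (\int[P]_w ((X w)%:R : R)%:E)%E.

Lemma natE_ge0 X : (0 <= natE X)%E.
Proof. by apply: integral_ge0 => w _; rewrite lee_fin. Qed.

Let mR X : dmeas X -> measurable_fun setT (fun w => ((X w)%:R : R)%:E).
Proof. by move=> mX _ Y _; rewrite setTI; exact: (mX [set n | Y (n%:R)%:E]). Qed.

Lemma eq_natE X Y : X =1 Y -> natE X = natE Y.
Proof. by move=> XY; apply: eq_integral => w _; rewrite XY. Qed.

Lemma natE_le X Y : dmeas X -> dmeas Y -> (forall w, (X w <= Y w)%N) ->
  (natE X <= natE Y)%E.
Proof.
move=> mX mY XY; apply: ge0_le_integral => //; try exact: mR.
all: by move=> w _; rewrite lee_fin// ler_nat.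
Qed.

Lemma natE_cst n : natE (fun=> n) = (n%:R)%:E.
Proof. by rewrite /natE integral_cst//= probability_setT mule1. Qed.

Lemma natE_indic (A : set T) : measurable A -> natE (fun w => (w \in A) : nat) = P A.
Proof.
by move=> mA; rewrite -[A in RHS]setIT -integral_indic.
Qed.

Lemma natED X Y : dmeas X -> dmeas Y ->
  natE (fun w => X w + Y w)%N = (natE X + natE Y)%E.
Proof.
move=> mX mY; rewrite /natE -ge0_integralD//; first last.
- exact: mR.
- exact: mR.
by apply: eq_integral => w _; rewrite natrD EFinD.
Qed.

Lemma natEZ c X : dmeas X -> natE (fun w => c * X w)%N = ((c%:R)%:E * natE X)%E.
Proof.
move=> mX; rewrite /natE -ge0_integralZl//; last exact: mR.
by apply: eq_integral => w _; rewrite natrM EFinM.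
Qed.

End nat_expectation.

Section series.
Variable R : realType.

Lemma nneseries_ltn (n : nat) :
  (\sum_(0 <= j <oo) ((j < n)%N%:R : R)%:E = (n%:R)%:E)%E.
Proof.
rewrite (nneseries_split 0 n)//= add0n [X in (_ + X)%E]eseries0 ?adde0; last first.
  by move=> j nj _; rewrite ltnNge nj.
rewrite sumEFin -natr_sum; congr ((_%:R)%:E).
rewrite big_nat (eq_bigr (fun=> 1%N)) -?big_nat ?sum_nat_const_nat ?muln1 ?subn0//.
by move=> j /andP[_ ->].
Qed.

Lemma nneseries_eqn (a : nat -> nat) (n : nat) :
  (\sum_(0 <= j <oo) (((n == j) * a j)%N%:R : R)%:E = ((a n)%:R)%:E)%E.
Proof.
rewrite (nneseries_split 0 n.+1)//= add0n [X in (_ + X)%E]eseries0 ?adde0; last first.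
  by move=> j nj _; rewrite ltn_eqF.
rewrite sumEFin big_nat_recr//= eqxx mul1n big_nat big1 ?add0r//.
by move=> j /andP[_ jn]; rewrite gtn_eqF.
Qed.

End series.

Section independent_expectation.
Context (dT : measure_display) (T : measurableType dT) (R : realType).
Variable P : probability T R.
Implicit Types X Y N : T -> nat.
Local Notation dmeas := (discretely_measurable (@measurable _ T)).
Local Notation natE := (natE P).

Let mR X : dmeas X -> measurable_fun setT (fun w => ((X w)%:R : R)%:E).
Proof. by move=> mX _ Y _; rewrite setTI; exact: (mX [set n | Y (n%:R)%:E]). Qed.

Definition independent_variables (A B : Type) (X : T -> A) (Y : T -> B) :=
  forall C D, P (X @^-1` C `&` Y @^-1` D) = (P (X @^-1` C) * P (Y @^-1` D))%E.

Lemma natE_series (a : nat -> T -> nat) X : (forall j, dmeas (a j)) ->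
  (forall w, \sum_(0 <= j <oo) ((a j w)%:R : R)%:E = ((X w)%:R)%:E)%E ->
  (natE X = \sum_(0 <= j <oo) natE (a j))%E.
Proof.
move=> ma aX; rewrite -integral_nneseries//; last by move=> j; exact: mR.
by apply: eq_integral => w _; rewrite aX.
Qed.

Lemma natE_tail X : dmeas X ->
  (natE X = \sum_(0 <= j <oo) P (X @^-1` [set n | (j < n)%N]))%E.
Proof.
move=> mX; rewrite (natE_series (a := fun j w => (j < X w)%N)).
- apply: eq_eseriesr => j _; rewrite -natE_indic; last exact: mX.
  by apply: eq_natE => w; rewrite mem_setE.
- by move=> j; exact: (discretely_measurable_comp (fun n => (j < n)%N : nat) mX).
- by move=> w; exact: nneseries_ltn.
Qed.

(** Compare tail sums: the product exceeds [j] exactly on the part of [A] where [Y] exceeds [j]. *)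
Lemma natE_indicM (A : set T) Y : measurable A -> dmeas Y ->
  (forall B, P (A `&` Y @^-1` B) = (P A * P (Y @^-1` B))%E) ->
  natE (fun w => (w \in A) * Y w)%N = (P A * natE Y)%E.
Proof.
move=> mA mY ind.
have PA : P A = (fine (P A))%:E by rewrite fineK// fin_num_measure.
have mAY : dmeas (fun w => (w \in A) * Y w)%N.
  apply: (@discretely_measurable2 _ _ (sigma_algebra_measurable T) bool nat _ muln) => //.
  exact: (discretely_measurable_mem (sigma_algebra_measurable T)).
rewrite natE_tail// (natE_tail mY) PA -nneseriesZl// -PA.
apply: eq_eseriesr => j _; rewrite -ind; congr (P _).
apply/seteqP; split=> w /=; have [wA|wA] := pselect (A w).
- by rewrite mem_set// mul1n.
- by rewrite memNset.
- by rewrite mem_set// mul1n => -[].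
- by case.
Qed.

(** A null event is independent of everything. The mean of [Y] may be infinite, since 0 times
    infinity is 0 in the extended reals. *)
Lemma natE_indicM_null (A : set T) Y : measurable A -> dmeas Y -> P A = 0%E ->
  natE (fun w => (w \in A) * Y w)%N = 0%E.
Proof.
move=> mA mY PA0; rewrite natE_indicM// ?PA0 ?mul0e// => B.
rewrite mul0e; apply/eqP; rewrite -measure_le0 -PA0 le_measure ?inE//.
exact: measurableI.
Qed.

(** Writing [X] as the sum of the indicators of [j < X] reduces to [natE_indicM]; a finite mean of
    [Y] can be pulled out of the series as a real factor. *)
Lemma natEM X Y : dmeas X -> dmeas Y -> independent_variables X Y ->
  (natE Y < +oo)%E -> natE (fun w => X w * Y w)%N = (natE X * natE Y)%E.
Proof.
move=> mX mY ind Yoo.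
have YE : natE Y = (fine (natE Y))%:E.
  by rewrite fineK// ge0_fin_numE// natE_ge0.
have sT := sigma_algebra_measurable T.
rewrite (natE_series (a := fun j w => ((j < X w) * Y w)%N)); last first.
- move=> w; rewrite natrM mulrC EFinM -(nneseries_ltn _ (X w)) -nneseriesZl//.
  by apply: eq_eseriesr => j _; rewrite natrM mulrC EFinM.
- move=> j; apply: (@discretely_measurable2 _ _ sT bool nat _ muln) => //.
  exact: (discretely_measurable_comp (fun n => (j < n)%N) mX).
rewrite muleC YE (natE_tail mX) -nneseriesZl// -YE.
apply: eq_eseriesr => j _; rewrite muleC -natE_indicM//.
- by apply: eq_natE => w; rewrite mem_setE.
Qed.

(** Split over the events [N = l]; each [S l] is compared with [N] separately. *)
Lemma natE_random_index N (S : nat -> T -> nat) : dmeas N -> (forall l, dmeas (S l)) ->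
  (forall l, independent_variables N (S l)) ->
  (natE (fun w => S (N w) w) = \sum_(0 <= l <oo) P (N @^-1` [set l]) * natE (S l))%E.
Proof.
move=> mN mS ind; have sT := sigma_algebra_measurable T.
rewrite (natE_series (a := fun l w => ((N w == l) * S l w)%N)); last first.
- by move=> w; exact: nneseries_eqn.
- move=> l; apply: (@discretely_measurable2 _ _ sT bool nat _ muln) => //.
  exact: (discretely_measurable_comp (fun n => n == l) mN).
apply: eq_eseriesr => l _; rewrite -natE_indicM//.
- apply: eq_natE => w; congr (_ * _)%N; congr nat_of_bool.
  by apply/eqP/idP => [Nl|]; rewrite inE.
- by move=> B; exact: ind.
Qed.

Lemma natE_countable N (f : nat -> nat) : dmeas N ->
  (natE (f \o N) = \sum_(0 <= l <oo) P (N @^-1` [set l]) * ((f l)%:R)%:E)%E.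
Proof.
move=> mN; have sT := sigma_algebra_measurable T.
rewrite [LHS](natE_random_index (S := fun l _ => f l))//.
- by apply: eq_eseriesr => l _; rewrite natE_cst.
- by move=> l; exact: discretely_measurable_cst.
move=> l C D; have [Dl|Dl] := pselect (D (f l)).
  rewrite (_ : (fun=> f l) @^-1` D = setT) ?setIT ?probability_setT ?mule1//.
  by apply/seteqP; split.
by rewrite (_ : (fun=> f l) @^-1` D = set0) ?setI0 ?measure0 ?mule0//; apply/seteqP; split.
Qed.

End independent_expectation.

Section sum_moments.
Context (dT : measure_display) (T : measurableType dT) (R : realType).
Variable P : probability T R.
Local Notation dmeas := (discretely_measurable (@measurable _ T)).
Local Notation natE := (natE P).
Local Notation independent_variables := (independent_variables P).

Lemma discretely_measurable_sum (J : Type) (s : seq J) (X : J -> T -> nat) :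
  (forall j, dmeas (X j)) -> dmeas (fun w => \sum_(j <- s) X j w)%N.
Proof.
move=> mX; have sT := sigma_algebra_measurable T; elim: s => [|j s IH].
  rewrite (_ : (fun w => _) = fun=> 0%N); first exact: discretely_measurable_cst.
  by apply/funext => w; rewrite big_nil.
rewrite (_ : (fun w => _) = (fun w => X j w + \sum_(j <- s) X j w)%N).
  exact: (discretely_measurable2 sT addn).
by apply/funext => w; rewrite big_cons.
Qed.

Lemma natE_sum (J : Type) (s : seq J) (X : J -> T -> nat) :
  (forall j, dmeas (X j)) ->
  (natE (fun w => \sum_(j <- s) X j w)%N = \sum_(j <- s) natE (X j))%E.
Proof.
move=> mX; elim: s => [|j s IH].
  by rewrite big_nil (eq_natE _ (Y := fun=> 0%N)) ?natE_cst// => w; rewrite big_nil.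
rewrite big_cons -IH -natED//; first by apply: eq_natE => w; rewrite big_cons.
exact: discretely_measurable_sum.
Qed.

Lemma independent_variables_comp (A B A' B' : Type) (X : T -> A) (Y : T -> B)
  (f : A -> A') (g : B -> B') :
  independent_variables X Y -> independent_variables (f \o X) (g \o Y).
Proof. by move=> ind C D; exact: (ind (f @^-1` C) (g @^-1` D)). Qed.

Definition partial_sum (Y : nat -> T -> nat) (l : nat) (w : T) : nat :=
  (\sum_(i < l) Y i w)%N.

Lemma partial_sumS Y l w : partial_sum Y l.+1 w = (partial_sum Y l w + Y l w)%N.
Proof. by rewrite /partial_sum big_ord_recr. Qed.

Lemma discretely_measurable_partial_sum Y l : (forall i, dmeas (Y i)) ->
  dmeas (partial_sum Y l).
Proof. by move=> mY; exact: (discretely_measurable_sum _ (fun i : 'I_l => mY i)). Qed.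

Lemma natE_partial_sumX (Y : nat -> T -> nat) (l m : nat) :
  (forall i, dmeas (Y i)) ->
  independent_variables (partial_sum Y l) (Y l) ->
  (forall b, (b <= m.+1)%N -> (natE (fun w => Y l w ^ b)%N < +oo)%E) ->
  (natE (fun w => partial_sum Y l.+1 w ^ m.+1)%N =
   natE (fun w => partial_sum Y l w ^ m.+1)%N +
   \sum_(i < m) ('C(m.+1, i.+1)%:R)%:E *
     (natE (fun w => partial_sum Y l w ^ (m - i))%N * natE (fun w => Y l w ^ i.+1)%N)
   + natE (fun w => Y l w ^ m.+1)%N)%E.
Proof.
move=> mY ind Yoo.
have mS := discretely_measurable_partial_sum l mY.
have mX (X : T -> nat) b : dmeas X -> dmeas (fun w => X w ^ b)%N.
  exact: (discretely_measurable_comp (fun n => n ^ b)%N).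
have sT := sigma_algebra_measurable T.
pose term i w := ('C(m.+1, i) * (partial_sum Y l w ^ (m.+1 - i) * Y l w ^ i))%N.
have mM i : dmeas (fun w => partial_sum Y l w ^ (m.+1 - i) * Y l w ^ i)%N.
  by apply: (discretely_measurable2 sT muln); exact: mX.
have Eterm i : (i <= m.+1)%N -> (natE (term i) = ('C(m.+1, i)%:R)%:E *
    (natE (fun w => partial_sum Y l w ^ (m.+1 - i))%N * natE (fun w => Y l w ^ i)%N))%E.
  move=> im; rewrite natEZ//; congr (_ * _)%E; apply: natEM; [exact: mX|exact: mX| |exact: Yoo].
  exact: (independent_variables_comp (fun n => n ^ _)%N (fun n => n ^ _)%N).
transitivity (\sum_(i < m.+2) natE (term i))%E.
  rewrite -natE_sum; last first.
    by move=> i; exact: (discretely_measurable_comp (fun n => 'C(m.+1, i) * n)%N).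
  by apply: eq_natE => w; rewrite partial_sumS expnDn.
rewrite big_ord_recr big_ord_recl/=; congr (_ + _ + _)%E.
- by apply: eq_natE => w; rewrite /term bin0 subn0 expn0 mul1n muln1.
- apply: eq_bigr => i _; rewrite Eterm /bump leq0n add1n ?subSS//.
  by rewrite ltnS ltnW.
- by apply: eq_natE => w; rewrite /term binn subnn expn0 !mul1n.
Qed.

(** The cross terms of [(S_l + Y_l)^k] involve only lower moments, each at most of order
    [q]; there are none for [k = 1], hence [c = 0], which keeps first moments bounded
    even for a recurrent walk. *)
Lemma sum_moment_le (D : R) (k : nat) : 0 <= D -> (0 < k)%N ->
  exists c, [/\ 0 <= c, k = 1%N -> c = 0 &
  forall (Y : nat -> T -> nat) (q M : R), 0 <= q <= 1 -> 0 <= M ->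
  (forall i, dmeas (Y i)) ->
  (forall l, independent_variables (partial_sum Y l) (Y l)) ->
  (forall b i, (0 < b < k)%N -> (natE (fun w => Y i w ^ b)%N <= (D * q)%:E)%E) ->
  (forall i, natE (fun w => Y i w ^ k)%N <= M%:E)%E ->
  forall l, (natE (fun w => partial_sum Y l w ^ k)%N <=
    (l%:R * M + c * l%:R ^+ k * q ^+ 2)%:E)%E].
Proof.
move=> D0; elim/ltn_ind: k => k IH k0.
(* For the lower powers the induction hypothesis with [M = D * q], together with [l <= l^b] and
   [q^2 <= q], leaves a single factor [q]. *)
have /choice[c cP] : forall b, exists c, (0 < b < k)%N -> 0 <= c /\
  forall (Y : nat -> T -> nat) (q : R), 0 <= q <= 1 ->
  (forall i, dmeas (Y i)) ->
  (forall l, independent_variables (partial_sum Y l) (Y l)) ->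
  (forall b i, (0 < b < k)%N -> (natE (fun w => Y i w ^ b)%N <= (D * q)%:E)%E) ->
  forall l, (natE (fun w => partial_sum Y l w ^ b)%N <= (c * l%:R ^+ b * q)%:E)%E.
  move=> b; have [/andP[b0 bk]|_] := boolP (0 < b < k)%N; last by exists 0.
  have [c [c0 _ H]] := IH b bk b0; exists (D + c) => _; split; first exact: addr_ge0.
  move=> Y q q01 mY ind YD l; have /andP[q0 q1] := q01.
  apply: (le_trans (H Y q (D * q) q01 _ mY ind _ _ l)).
  - by rewrite mulr_ge0.
  - by move=> b' i /andP[b'0 b'b]; apply: YD; rewrite b'0 (ltn_trans b'b).
  - by move=> i; apply: YD; rewrite b0.
  have l1 : l%:R <= l%:R ^+ b :> R.
    by rewrite -natrX ler_nat; case: l => // l; rewrite -[X in (X <= _)%N]expn1 leq_pexp2l.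
  rewrite lee_fin !mulrDl lerD//.
    by rewrite mulrCA mulrA ler_wpM2r// ler_wpM2l.
  rewrite ler_wpM2l ?mulr_ge0 ?exprn_ge0//.
  by rewrite expr2 ler_piMr.
case: k k0 IH c cP => // m _ _ c cP.
(* Each cross term contributes one factor [q] from the partial sum and one from the new summand, so
   passing from [l] to [l + 1] costs at most [K l^m q^2]. For order 1 the sum is empty. *)
pose K := \sum_(i < m) 'C(m.+1, i.+1)%:R * (c (m - i)%N * D).
have im (i : 'I_m) : (0 < m - i < m.+1)%N by rewrite subn_gt0 ltn_ord ltnS leq_subr.
have K0 : 0 <= K.
  by apply: sumr_ge0 => i _; rewrite !mulr_ge0//; have [] := cP _ (im i).
exists K; split=> //; first by case=> m0; rewrite /K m0 big_ord0.
move=> Y q M q01 M0 mY ind YD YM; have /andP[q0 q1] := q01.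
elim=> [|l IHl].
  rewrite (eq_natE _ (Y := fun=> 0%N)); last by move=> w; rewrite /partial_sum big_ord0 exp0n.
  by rewrite natE_cst mul0r exprS mul0r mulr0 mul0r addr0.
rewrite natE_partial_sumX//; last first.
  move=> b; rewrite leq_eqVlt => /predU1P[->|bm].
    by apply: le_lt_trans (YM _) _; rewrite ltry.
  case: b bm => [_|b bm].
    by rewrite (eq_natE _ (Y := fun=> 1%N))// natE_cst ltry.
  by apply: le_lt_trans (YD _ _ _) _; rewrite ?ltry.
apply: (@le_trans _ _ ((l%:R * M + K * l%:R ^+ m.+1 * q ^+ 2) +
   (K * l%:R ^+ m * q ^+ 2) + M)%:E).
  rewrite !EFinD; apply: leeD => //; apply: leeD; first by rewrite -EFinD.
  rewrite /K !mulr_suml -sumEFin; apply: lee_sum => i _.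
  have [c0 H] := cP _ (im i).
  rewrite -!mulrA EFinM lee_wpmul2l ?lee_fin//.
  apply: (@le_trans _ _ ((c (m - i)%N * l%:R ^+ (m - i) * q)%:E * (D * q)%:E)%E).
    apply: lee_pmul; rewrite ?natE_ge0//.
      exact: (H Y q q01 mY ind YD).
    by apply: YD; rewrite /= ltnS.
  rewrite -EFinM lee_fin.
  have -> : c (m - i)%N * l%:R ^+ (m - i) * q * (D * q) =
    c (m - i)%N * D * (q ^+ 2 * l%:R ^+ (m - i)) by ring.
  have -> : c (m - i)%N * (D * (l%:R ^+ m * q ^+ 2)) =
    c (m - i)%N * D * (q ^+ 2 * l%:R ^+ m) by ring.
  rewrite ler_wpM2l ?mulr_ge0// ler_wpM2l ?sqr_ge0//.
  rewrite -!natrX ler_nat; case: l {IHl} => [|l]; last by rewrite leq_pexp2l// leq_subr.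
  by rewrite exp0n// subn_gt0.
rewrite lee_fin.
(* Here [l^(m+1) + l^m = l^m (l + 1) <= (l + 1)^(m+1)]. *)
have -> : l%:R * M + K * l%:R ^+ m.+1 * q ^+ 2 + K * l%:R ^+ m * q ^+ 2 + M =
  l.+1%:R * M + K * (l%:R ^+ m * l.+1%:R) * q ^+ 2 by rewrite -natr1 exprS; ring.
rewrite lerD2l ler_wpM2r ?sqr_ge0// ler_wpM2l// exprSr ler_wpM2r//.
by rewrite lerXn2r ?nnegrE// ler_nat.
Qed.

End sum_moments.

(** * The branching random walk *)

Section tree.

(** [generation] grows the tree at its leaves, whereas the recursion for the moments splits it at
    the root. Descendants of child [i] are the labels whose last letter is [i]. *)
Lemma generation_first (k : label -> nat) n : generation k n.+1 =
  [seq rcons v i | i <- iota 0 (k [::]), v <- generation (fun u => k (rcons u i)) n].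
Proof.
elim: n => [|n IH].
  by rewrite /= cats0; elim: (iota _ _) => //= i s ->.
rewrite [LHS]/= -/(generation k n.+1) IH.
elim: (iota _ _) => //= i s IHs; rewrite map_cat flatten_cat IHs; congr (_ ++ _).
elim: (generation _ n) => //= v g IHg.
rewrite map_cat -IHg; congr (_ ++ _).
by rewrite -map_comp; apply: eq_map.
Qed.

Lemma position_rcons (d : nat) (s : label -> 'rV[int]_d) v i :
  position s (rcons v i) = s [:: i] + position (fun u => s (rcons u i)) v.
Proof.
elim: v => [|j v IH]; first by rewrite /= add0r addr0.
by rewrite rcons_cons /= IH addrA.
Qed.

End tree.

Section tree_measurability.
Context (dT : measure_display) (T : measurableType dT).
Variables (G : set (set T)) (sG : sigma_algebra setT G).
Variables (d : nat) (xi : label -> T -> nat) (step : label -> T -> 'rV[int]_d).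
Hypothesis mxi : forall u, discretely_measurable G (xi u).
Hypothesis mstep : forall u, u != [::] -> discretely_measurable G (step u).

(** With [G] generated by the coordinates of a subtree, this records which part of the driver the
    generation depends on. *)
Lemma discretely_measurable_generation n :
  discretely_measurable G (fun w => generation (xi^~ w) n).
Proof.
elim: n => [|n IH]; first exact: discretely_measurable_cst.
pose children (g : seq label) w := [seq i :: u | u <- g, i <- iota 0 (xi u w)].
apply: (discretely_measurable_bind sG (F := children) IH).
elim=> [|u g IHg]; first exact: (discretely_measurable_cst sG).
apply: (discretely_measurable2 sG (fun k s => [seq i :: u | i <- iota 0 k] ++ s)) => //.
Qed.

Lemma discretely_measurable_position u :
  discretely_measurable G (fun w => position (step^~ w) u).
Proof.
elim: u => [|i u IH]; first exact: (discretely_measurable_cst sG).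
by apply: (discretely_measurable2 sG (fun x y : 'rV[int]_d => x + y)) => //; exact: mstep.
Qed.

Lemma discretely_measurable_U n x : discretely_measurable G (U xi step n x).
Proof.
apply: (discretely_measurable_bind sG
  (F := fun g w => count (fun u => position (step^~ w) u == x) g)
  (discretely_measurable_generation n)).
elim=> [|u g IHg]; first exact: (discretely_measurable_cst sG).
apply: (discretely_measurable2 sG (fun y m => (y == x) + m)%N) => //.
exact: discretely_measurable_position.
Qed.

End tree_measurability.

Section shift.
Context (dT : measure_display) (T : measurableType dT) (R : realType).
Variables (P : probability T R) (Q : probability nat R) (d : nat).
Implicit Types (xi : label -> T -> nat) (step : label -> T -> 'rV[int]_d).

(** Restriction of a family indexed by labels to the descendants of child [i] of the
    initial particle: the oldest ancestor is the last letter of a label. *)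
Definition shift (A : Type) (i : nat) (f : label -> A) : label -> A :=
  fun u => f (rcons u i).

Lemma U_first xi step n x w : U xi step n.+1 x w =
  (\sum_(i < xi [::] w)
     U (shift i xi) (shift i step) n (x - step [:: val i] w) w)%N.
Proof.
rewrite /U generation_first count_flatten sumnE !big_map.
rewrite -{1}(subn0 (xi [::] w)) big_mkord; apply: eq_bigr => i _.
rewrite count_map; apply: eq_count => v /=.
by rewrite position_rcons [RHS]eq_sym subr_eq eq_sym addrC.
Qed.

Lemma size_generation_first xi n w : size (generation (xi^~ w) n.+1) =
  (\sum_(i < xi [::] w) size (generation ((shift i xi)^~ w) n))%N.
Proof.
rewrite generation_first size_allpairs_dep sumnE !big_map.
by rewrite -{1}(subn0 (xi [::] w)) big_mkord.
Qed.

(** This makes inductions on [n] over all drivers possible. Relabelling is injective, so finite sets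
    of coordinates go to finite sets of coordinates. *)
Lemma brw_driver_shift xi step i :
  brw_driver xi step P Q -> brw_driver (shift i xi) (shift i step) P Q.
Proof.
case=> mxi mstep lxi lstep ind; split=> [u B|u B|u B|u z|B C J].
- exact: mxi.
- exact: mstep.
- exact: lxi.
- exact: lstep.
(* Deletes the oldest ancestor, the last letter; as a left inverse of appending [i] it extends [B]
   and [C] to all labels. *)
pose parent (v : label) := take (size v).-1 v.
have parentK u : parent (rcons u i) = u.
  by rewrite /parent size_rcons -cats1 take_size_cat.
pose f (j : label + label) : label + label :=
  match j with inl u => inl (rcons u i) | inr u => inr (rcons u i) end.
have f_inj : injective f by move=> [u|u] [v|v] //= [] /rcons_inj[->].
have := ind (B \o parent) (C \o parent) [fset f j | j in J]%fset.
rewrite big_imfset/=; last by move=> ? ? _ _; exact: f_inj.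
rewrite (_ : \bigcap_(j in _) _ = \bigcap_(j in [set` J]) match j with
  | inl u => shift i xi u @^-1` B u | inr u => shift i step u @^-1` C u end).
  by move=> ->; apply: eq_bigr => -[u|u] _ /=; rewrite parentK.
apply/seteqP; split=> w H.
  move=> j /= jJ; have /= := H (f j) (in_imfset _ _ jJ).
  by case: j {jJ} => u /=; rewrite parentK.
move=> _ /= /imfsetP[j /= jJ ->]; have := H j jJ.
by case: j {jJ} => u /=; rewrite parentK.
Qed.

End shift.

(** * Independence of the subtrees *)

Section driver_independence.
Context (dT : measure_display) (T : measurableType dT) (R : realType).
Variables (P : probability T R) (Q : probability nat R) (d : nat).
Variables (xi : label -> T -> nat) (step : label -> T -> 'rV[int]_d).
Hypothesis drv : brw_driver xi step P Q.

Definition driver_events (j : label + label) : set (set T) :=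
  match j with
  | inl u => [set E | exists B, E = xi u @^-1` B]
  | inr u => [set E | exists C, E = step u @^-1` C]
  end.

Let mE j : driver_events j `<=` measurable.
Proof.
by case: j => u _ [B ->]; [exact: (brw_measurable_xi drv)|exact: (brw_measurable_step drv)].
Qed.

Let ET j : driver_events j setT.
Proof. by case: j => u; exists setT; rewrite preimage_setT. Qed.

Let EI j : setI_closed (driver_events j).
Proof. by case: j => u _ _ [B ->] [C ->]; exists (B `&` C); rewrite preimage_setI. Qed.

Let Eind (A : label + label -> set T) : (forall j, driver_events j (A j)) ->
  independent_events P A.
Proof.
move=> EA; pose B u := sval (cid (EA (inl u))); pose C u := sval (cid (EA (inr u))).
rewrite (_ : A = fun j => match j with
  | inl u => xi u @^-1` B u | inr u => step u @^-1` C u end).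
  exact: (brw_independent drv B C).
by apply/funext => -[u|u]; rewrite /B /C; case: cid.
Qed.

Definition depends (S : set (label + label)) (A : Type) (X : T -> A) :=
  discretely_measurable <<s cylinders driver_events S >> X.

Lemma depends_subset (S S' : set (label + label)) (A : Type) (X : T -> A) :
  S `<=` S' -> depends S X -> depends S' X.
Proof.
move=> SS' SX B; apply: sub_sigma_algebra2 (SX B).
exact: cylinders_subset.
Qed.

Lemma depends_measurable S (A : Type) (X : T -> A) : depends S X ->
  discretely_measurable measurable X.
Proof. by move=> SX B; apply: (sigma_cylinders_measurable mE (SX B)). Qed.

Lemma depends_independent S S' (A B : Type) (X : T -> A) (Y : T -> B) :
  S `&` S' = set0 -> depends S X -> depends S' Y -> independent_variables P X Y.
Proof.
by move=> SS' SX SY C D; apply: (sigma_cylinders_indep mE ET EI Eind SS' (SX C) (SY D)).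
Qed.

Lemma depends_xi (S : set (label + label)) u : S (inl u) -> depends S (xi u).
Proof.
move=> Su B; apply: sub_sigma_algebra.
by apply: (@sub_cylinders _ _ _ driver_events ET _ _ Su); exists B.
Qed.

Lemma depends_step (S : set (label + label)) u : S (inr u) -> depends S (step u).
Proof.
move=> Su B; apply: sub_sigma_algebra.
by apply: (@sub_cylinders _ _ _ driver_events ET _ _ Su); exists B.
Qed.

(** Child [i] itself is included ([u = [::]]), with its displacement; the offspring number of the
    initial particle is not. *)
Definition subtree (i : nat) : set (label + label) :=
  [set j | exists u, j = inl (rcons u i) \/ j = inr (rcons u i)].

Lemma subtree_disjoint i j : i != j -> subtree i `&` subtree j = set0.
Proof.
move=> /eqP ij; apply/seteqP; split=> // x [/= [u ux] [v vx]].
by case: ux vx => -> [] e; case: e => // /rcons_inj[_ /ij].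
Qed.

Lemma depends_shift_generation i n :
  depends (subtree i) (fun w => generation ((shift i xi)^~ w) n).
Proof.
apply: discretely_measurable_generation => // u.
by apply: depends_xi; exists u; left.
Qed.

(** The displacement [step [:: i]] must be excluded: it is needed as an independent
    shift of the starting point of the subtree. *)
Lemma depends_shift_U i n x :
  depends (subtree i `\ inr [:: i]) (U (shift i xi) (shift i step) n x).
Proof.
apply: discretely_measurable_U => // u => [|u0].
  by apply: depends_xi; split=> //; exists u; left.
apply: depends_step; split; first by exists u; right.
by case: u u0 => // a u _ [_] /(congr1 size); rewrite size_rcons.
Qed.

(** The contribution of child [i] to generation [n + 1] at [x], with the target site seen from the
    child. *)
Definition branch n x i w := U (shift i xi) (shift i step) n (x - step [:: i] w) w.

Lemma depends_branch n x i : depends (subtree i) (branch n x i).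
Proof.
apply: (@discretely_measurable_bind _ _ _ 'rV[int]_d nat (step [:: i])
  (fun z => U (shift i xi) (shift i step) n (x - z))) => //.
- by apply: depends_step; exists [::]; right.
- move=> z; apply: (@depends_subset (subtree i `\ inr [:: i]) (subtree i)).
    by move=> j [].
  exact: depends_shift_U.
Qed.

Lemma depends_partial_sum (Y : nat -> T -> nat) l :
  (forall i, depends (subtree i) (Y i)) ->
  depends (\bigcup_(i in `I_l) subtree i) (partial_sum Y l).
Proof.
move=> SY; elim: l => [|l IH].
  rewrite (_ : partial_sum Y 0 = fun=> 0%N); first exact: discretely_measurable_cst.
  by apply/funext => w; rewrite /partial_sum big_ord0.
rewrite (_ : partial_sum Y l.+1 = fun w => (partial_sum Y l w + Y l w)%N); last first.
  by apply/funext => w; rewrite partial_sumS.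
apply: (discretely_measurable2 _ addn) => //.
- by apply: depends_subset IH => j [i /= il ij]; exists i => //=; exact: ltnW.
- by apply: depends_subset (SY l) => j jl; exists l => /=.
Qed.

Lemma independent_partial_sum (Y : nat -> T -> nat) l :
  (forall i, depends (subtree i) (Y i)) ->
  independent_variables P (partial_sum Y l) (Y l).
Proof.
move=> SY; have SS : (\bigcup_(i in `I_l) subtree i) `&` subtree l = set0; last first.
  exact: (depends_independent SS (depends_partial_sum SY) (SY l)).
rewrite setI_bigcupl bigcup0// => i /= il.
by rewrite subtree_disjoint// ltn_eqF.
Qed.

Lemma independent_root_partial_sum (Y : nat -> T -> nat) l :
  (forall i, depends (subtree i) (Y i)) ->
  independent_variables P (xi [::]) (partial_sum Y l).
Proof.
move=> SY; have SS : [set inl [::]] `&` (\bigcup_(i in `I_l) subtree i) = set0; last first.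
  exact: (depends_independent SS (depends_xi _) (depends_partial_sum SY)).
apply/seteqP; split=> // j [/= -> [i _ [u [|//]]]] [] /(congr1 size).
by rewrite size_rcons.
Qed.

Lemma natE_xi u (f : nat -> nat) : natE P (f \o xi u) = natE Q f.
Proof.
rewrite natE_countable; last exact: (brw_measurable_xi drv).
rewrite (natE_countable Q f (N := id))//.
by apply: eq_eseriesr => l _; rewrite (brw_law_xi drv).
Qed.

(** The law is given on singletons, hence the countable union of null events. *)
Lemma step_unit_steps_ae u : P (step u @^-1` [set z | z \notin unit_steps d]) = 0%E.
Proof.
apply/negligibleP; first exact: (brw_measurable_step drv).
rewrite (_ : _ @^-1` _ = \bigcup_n (if @choice.unpickle 'rV[int]_d n is Some z then
    if z \in unit_steps d then set0 else step u @^-1` [set z] else set0)); last first.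
  apply/seteqP; split=> [w /= /negPf zw|w [n _]].
    by exists (choice.pickle (step u w)) => //; rewrite choice.pickleK zw.
  by case: choice.unpickle => // z; case: ifPn => //= zE ->.
apply: negligible_bigcup => n; case: choice.unpickle => [z|]; last exact: negligible_set0.
case: ifPn => zE; first exact: negligible_set0.
apply/negligibleP; first exact: (brw_measurable_step drv).
apply: (etrans (brw_law_step drv u z)); case: ifP => // /mem_unit_steps.
by rewrite (negPf zE).
Qed.

(** Condition on the displacement of child [i], which is independent of the rest of its subtree. For
    an upper bound it is enough that the events [step [:: i] = e] and the null event [A] cover the
    space. *)
Lemma natE_branch_le n x i b (F : 'rV[int]_d -> R) :
  (forall y, natE P (fun w => U (shift i xi) (shift i step) n y w ^ b)%N <= (F y)%:E)%E ->
  (natE P (fun w => branch n x i w ^ b)%N <=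
   ((\sum_(e <- unit_steps d) F (x - e)) / (size (unit_steps d))%:R)%:E)%E.
Proof.
move=> UF; have sT := sigma_algebra_measurable T.
pose A := step [:: i] @^-1` [set z | z \notin unit_steps d].
pose V e w := (U (shift i xi) (shift i step) n (x - e) w ^ b)%N.
have mA : measurable A by exact: (brw_measurable_step drv).
have mse e : measurable (step [:: i] @^-1` [set e]) by exact: (brw_measurable_step drv).
have mX (X : T -> nat) : discretely_measurable measurable X ->
    discretely_measurable measurable (fun w => X w ^ b)%N.
  exact: (discretely_measurable_comp (fun m => m ^ b)%N).
have mV e : discretely_measurable measurable (V e).
  by apply: mX; exact (depends_measurable (@depends_shift_U i n (x - e))).
have mB : discretely_measurable measurable (fun w => branch n x i w ^ b)%N.
  by apply: mX; exact (depends_measurable (@depends_branch n x i)).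
have mI (B : set T) (X : T -> nat) : measurable B -> discretely_measurable measurable X ->
    discretely_measurable measurable (fun w => (w \in B) * X w)%N.
  move=> mB' mX'; apply: (@discretely_measurable2 _ _ sT bool nat _ muln) => //.
  exact: discretely_measurable_mem.
have mS : discretely_measurable measurable
    (fun w => \sum_(e <- unit_steps d) (w \in step [:: i] @^-1` [set e]) * V e w)%N.
  by apply: discretely_measurable_sum => e; exact: mI.
apply: (@le_trans _ _ (natE P (fun w =>
    \sum_(e <- unit_steps d) (w \in step [:: i] @^-1` [set e]) * V e w +
    (w \in A) * branch n x i w ^ b)%N)).
  apply: natE_le => //.
    by apply: (discretely_measurable2 sT addn) => //; exact: mI.
  move=> w; have [sE|sE] := boolP (step [:: i] w \in unit_steps d).
    by rewrite (big_rem _ sE)/= mem_set// mul1n -addnA leq_addr.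
  by rewrite [w \in A]mem_set// mul1n leq_addl.
rewrite natED//; last exact: mI.
rewrite (natE_indicM_null mA mB) ?step_unit_steps_ae// adde0.
rewrite natE_sum; last by move=> e; exact: mI.
rewrite mulr_suml -sumEFin; apply: lee_sum => e _.
rewrite natE_indicM//; last first.
  have SS : [set inr [:: i]] `&` (subtree i `\ inr [:: i]) = set0.
    by apply/seteqP; split=> // j [/= -> []].
  have ind := depends_independent SS (depends_step erefl) (@depends_shift_U i n (x - e)).
  by move=> B; exact: (ind [set e] ((fun m => m ^ b)%N @^-1` B)).
rewrite muleC EFinM; apply: lee_pmul; rewrite ?natE_ge0 ?measure_ge0//.
  exact: UF.
rewrite (brw_law_step drv) size_unit_steps; by case: ifP; rewrite // lee_fin invr_ge0.
Qed.

End driver_independence.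

(** * The moment recursion *)

Section moments.
Context (dT : measure_display) (T : measurableType dT) (R : realType).
Variables (P : probability T R) (Q : probability nat R).
Hypothesis Q1 : natE Q id = 1%E.

Local Notation dmeas := (discretely_measurable (@measurable _ T)).

Lemma measurable_U d (xi : label -> T -> nat) (step : label -> T -> 'rV[int]_d) n x :
  brw_driver xi step P Q -> dmeas (U xi step n x).
Proof.
move=> drv; apply: discretely_measurable_U; first exact: sigma_algebra_measurable.
- exact: (brw_measurable_xi drv).
- by move=> u _; exact: (brw_measurable_step drv).
Qed.

Lemma measurable_generation d (xi : label -> T -> nat) (step : label -> T -> 'rV[int]_d) n :
  brw_driver xi step P Q -> dmeas (fun w => generation (xi^~ w) n).
Proof.
move=> drv; apply: discretely_measurable_generation; first exact: sigma_algebra_measurable.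
exact: (brw_measurable_xi drv).
Qed.

(** Uniform in the driver, because removing the initial particle leads to shifted drivers. The
    factor [a n] may grow, as it does for the second moment in dimension 0. *)
Definition moment_bound d (k : nat) (a : nat -> R) :=
  forall n xi (step : label -> T -> 'rV[int]_d),
  brw_driver xi step P Q -> forall x,
  (natE P (fun w => U xi step n x w ^ k)%N <= (a n * walk_law R (unit_steps d) n x)%:E)%E.

(** Given [N] children, [sum_moment_le] yields [N M + c N^k q^2] with [q = p_(n+1)(x)]. In the mean
    [N] gives 1, so [M] is reproduced without growth, and [q^2 <= s (n + 1) * q] is the increment.
    The sequence [s] is left free: summable for transient walks, constantly 1 in dimension 0. *)
Lemma moment_recursion d k (D : R) (s : nat -> R) : (0 < k)%N -> 0 <= D ->
  (forall b, (0 < b < k)%N -> moment_bound d b (fun=> D)) ->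
  (natE Q (fun l => l ^ k)%N < +oo)%E ->
  (forall n x, walk_law R (unit_steps d) n x <= s n) ->
  exists C, [/\ 0 <= C, k = 1%N -> C = 0 &
    moment_bound d k (fun n => 1 + C * \sum_(j < n) s j.+1)].
Proof.
move=> k0 D0 HD Qk ps.
have p0 := walk_law_ge0 R (unit_steps d).
have s0 n : 0 <= s n by exact: le_trans (p0 n 0) (ps n 0).
have [c [c0 c1 sumP]] := sum_moment_le P D0 k0.
have [B QB] : exists B : R, natE Q (fun l => l ^ k)%N = B%:E.
  by exists (fine (natE Q (fun l => l ^ k)%N)); rewrite fineK// ge0_fin_numE ?natE_ge0.
have B0 : 0 <= B by rewrite -lee_fin -QB natE_ge0.
exists (c * B); split; [exact: mulr_ge0|by move=> /c1 ->; rewrite mul0r|].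
elim=> [|n IH] xi step drv x.
  rewrite big_ord0 mulr0 addr0 mul1r walk_law0 (eq_natE P (Y := fun=> (x == 0%R) : nat)).
    by rewrite natE_cst.
  by move=> w; rewrite /U /= addn0 eq_sym; case: (_ == _); rewrite ?exp1n ?exp0n.
set q := walk_law _ _ n.+1 x.
set S := \sum_(j < n) s j.+1.
set M := (1 + c * B * S) * q.
have M0 : 0 <= M.
  by rewrite mulr_ge0 ?p0// addr_ge0// !mulr_ge0// sumr_ge0.
have avg (a : R) : (\sum_(e <- unit_steps d) a * walk_law R (unit_steps d) n (x - e)) /
    (size (unit_steps d))%:R = a * q.
  by rewrite /q walk_lawS// -mulr_sumr mulrA.
have Yb i b (a : R) : (forall xi (step : label -> T -> 'rV[int]_d),
    brw_driver xi step P Q -> forall x, (natE P (fun w => U xi step n x w ^ b)%N <=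
      (a * walk_law R (unit_steps d) n x)%:E)%E) ->
    (natE P (fun w => branch xi step n x i w ^ b)%N <= (a * q)%:E)%E.
  move=> H; rewrite -avg; apply: (natE_branch_le drv x
    (F := fun y => a * walk_law R (unit_steps d) n y)) => y.
  exact/H/brw_driver_shift.
have q01 : 0 <= q <= 1 by rewrite p0 walk_law_le1.
have SY i : depends xi step (subtree i) (branch xi step n x i).
  by exact (@depends_branch _ _ _ xi step n x i).
have mY i : dmeas (branch xi step n x i).
  exact (depends_measurable drv (SY i)).
have sumB := sumP (branch xi step n x) q M q01 M0 mY
  (fun l => independent_partial_sum drv l SY)
  (fun b i bk => Yb i b D (fun xi step drv => HD b bk n xi step drv))
  (fun i => Yb i k _ IH).
rewrite (eq_natE P (Y := fun w => partial_sum (branch xi step n x) (xi [::] w) w ^ k)%N);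
  last by move=> w; rewrite U_first.
have mS l : dmeas (partial_sum (branch xi step n x) l).
  exact: discretely_measurable_partial_sum.
rewrite (natE_random_index (S := fun l w => partial_sum (branch xi step n x) l w ^ k)%N).
- apply: (@le_trans _ _ (\sum_(0 <= l <oo) (M%:E * (P (xi [::] @^-1` [set l]) * (l%:R)%:E) +
     (c * q ^+ 2)%:E * (P (xi [::] @^-1` [set l]) * ((l ^ k)%:R)%:E))))%E.
    apply: lee_nneseries => [l _|l _]; first by rewrite mule_ge0 ?natE_ge0.
    apply: le_trans (lee_wpmul2l _ (sumB l)) _ => //.
    rewrite (_ : P _ = (fine (P (xi [::] @^-1` [set l])))%:E); last first.
      by rewrite fineK// fin_num_measure//; exact: (brw_measurable_xi drv).
    by rewrite -!EFinM -EFinD lee_fin natrX le_eqVlt; apply/orP; left; apply/eqP; ring.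
  have cq0 : 0 <= c * q ^+ 2 by rewrite mulr_ge0// sqr_ge0.
  rewrite nneseriesD; last 2 first.
  - by move=> l _ _; rewrite !mule_ge0// lee_fin.
  - by move=> l _ _; rewrite !mule_ge0// lee_fin.
  rewrite nneseriesZl; last by move=> l _; rewrite mule_ge0// lee_fin.
  rewrite nneseriesZl; last by move=> l _; rewrite mule_ge0// lee_fin.
  have mxi := brw_measurable_xi drv [::].
  rewrite -(natE_countable P id mxi) -(natE_countable P (fun l => l ^ k)%N mxi).
  rewrite (natE_xi drv [::] id) (natE_xi drv [::] (fun l => l ^ k)%N) Q1 QB mule1.
  rewrite -EFinM -EFinD lee_fin /M big_ord_recr/= -/S mulrDr addrA [leRHS]mulrDl lerD2l.
  rewrite [leLHS](_ : _ = c * B * (q * q)) ?expr2; last by ring.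
  rewrite -[leRHS]mulrA ler_wpM2l ?mulr_ge0// ler_wpM2r//; first by case/andP: q01.
  exact: ps.
- exact: (brw_measurable_xi drv).
- by move=> l; exact: (discretely_measurable_comp (fun m => m ^ k)%N (mS l)).
move=> l; have ind := independent_root_partial_sum drv l SY.
exact: (independent_variables_comp id (fun m => m ^ k)%N ind).
Qed.

End moments.

(** * Weak convergence *)

Section weak_convergence.
Variable R : realType.

(** The integrand differs from [f 0] by at most [e] where [|x| <= r] and by at most [2 * M]
    elsewhere. *)
Lemma integral_near0_le (nu : {measure set R -> \bar R}) (f : R -> R) (M e r : R) :
  nu setT = 1%E -> continuous f -> (forall x, `|f x| <= M) -> 0 <= e ->
  (forall x, `|x| <= r -> `|f x - f 0| <= e) ->
  (\int[nu]_x (f x)%:E)%E \is a fin_num /\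
  `|fine (\int[nu]_x (f x)%:E)%E - f 0| <=
    e + 2 * M * fine (nu [set x | r < `|x| ]).
Proof.
move=> nu1 cf fM e0 fe.
have mf : measurable_fun setT f by exact: continuous_measurable_fun.
have nuoo : (nu setT < +oo)%E by rewrite nu1 ltry.
have M0 : 0 <= M by exact: le_trans (fM 0).
have intf : nu.-integrable setT (EFin \o f).
  apply: measurable_bounded_integrable => //.
  exists M; split; first exact: num_real.
  by move=> y My x _ /=; apply: le_trans (fM x) (ltW My).
have intc : nu.-integrable setT (EFin \o cst (f 0)).
  apply: measurable_bounded_integrable => //.
  exists `|f 0|; split; first exact: num_real.
  by move=> y My x _ /=; exact: ltW.
have fin : (\int[nu]_x (f x)%:E)%E \is a fin_num by exact: integrable_fin_num.
split=> //.
set A := [set x | _].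
have mA : measurable A.
  have mn : measurable_fun setT (fun x : R => `|x|) by exact: normr_measurable.
  have := mn measurableT `]r, +oo[%classic (measurable_itv _).
  rewrite setTI (_ : _ @^-1` _ = A)//.
  by apply/seteqP; split=> x /=; rewrite in_itv/= andbT.
have finA : nu A \is a fin_num.
  rewrite ge0_fin_numE//; apply: le_lt_trans nuoo; apply: le_measure; rewrite ?inE//.
rewrite -lee_fin.
have -> : (`|fine (\int[nu]_x (f x)%:E)%E - f 0|%:E =
    `|\int[nu]_x ((f x)%:E - (f 0)%:E)|)%E.
  rewrite integralB_EFin// integral_cst// [X in (_ * X)%E]nu1 mule1.
  by rewrite -{2}(fineK fin) -EFinB.
apply: le_trans (le_abse_integral nu measurableT _) _.
  apply: emeasurable_funB; exact/measurable_EFinP.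
have mI : measurable_fun setT (fun x => (2 * M)%:E * ((\1_A x : R))%:E)%E.
  by apply: measurable_funeM; exact/measurable_EFinP/measurable_indic.
apply: (@le_trans _ _ (\int[nu]_x (e%:E + (2 * M)%:E * (\1_A x)%:E))%E).
  apply: ge0_le_integral => //.
  - apply: measurableT_comp => //; apply: emeasurable_funB; exact/measurable_EFinP.
  - exact: emeasurable_funD.
  - move=> x _; rewrite -EFinB -EFinM -EFinD lee_fin /indic.
    have [xr|xr] := leP `|x| r.
      apply: le_trans (fe x xr) _; rewrite lerDl mulr_ge0// mulr_ge0//.
    have -> : x \in A by rewrite inE.
    rewrite mulr1; apply: le_trans (ler_normB _ _) _.
    have := fM x; have := fM 0; lra.
rewrite ge0_integralD//; last first.
- by move=> x _; rewrite mule_ge0// lee_fin ?mulr_ge0.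
rewrite integral_cst// nu1 mule1 ge0_integralZl//; last 2 first.
- exact/measurable_EFinP/measurable_indic.
- by rewrite lee_fin mulr_ge0.
by rewrite integral_indic// setIT EFinD [(2 * M * _)%:E]EFinM fineK.
Qed.

Context (dT : measure_display) (T : measurableType dT).

Lemma inv_fine_measure_ge0 (P : probability T R) (H : set T) : 0 <= (fine (P H))^-1.
Proof. by rewrite invr_ge0 fine_ge0. Qed.

(** The same set function as [cond_distribution], up to computation, packaged as a measure so that
    integration theory applies. *)
Definition cond_measure (P : probability T R) (H : set T) (X : T -> R)
  (mH : measurable H) (mX : measurable_fun setT X) : {measure set R -> \bar R}.
Proof.
refine (pushforward (mscale (NngNum (inv_fine_measure_ge0 P H)) (mrestr P mH)) X
  : {measure set R -> \bar R}).
exact: mX.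
Defined.

Lemma cvg_weakly_dirac0 (P : probability T R) (H : nat -> set T) (X : nat -> T -> R) :
  (forall n, measurable (H n)) -> (forall n, measurable_fun setT (X n)) ->
  (forall n, (0 < P (H n))%E) ->
  (forall r, 0 < r ->
    fine (cond_distribution P (H n) (X n) [set x | r < `|x| ]) @[n --> \oo] --> 0) ->
  cvg_weakly (fun n => cond_distribution P (H n) (X n)) (@dirac _ R 0 R).
Proof.
move=> mH mX PH cvg0 f cf [M fM].
have M0 : 0 <= M by exact: le_trans (fM 0).
have mf : measurable_fun setT f by exact: continuous_measurable_fun.
rewrite integral_dirac//; last exact/measurable_EFinP.
rewrite diracT mul1e.
pose nu n := cond_measure P (mH n) (mX n).
have nuE n : cond_distribution P (H n) (X n) = nu n :> (set R -> \bar R) by [].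
have nu1 n : nu n setT = 1%E.
  rewrite -nuE /cond_distribution preimage_setT setTI.
  have fPH : P (H n) \is a fin_num by exact: fin_num_measure.
  by rewrite -{2}(fineK fPH) -EFinM mulVf// gt_eqF// fine_gt0// PH ltey_eq fPH.
under eq_fun do rewrite nuE.
apply/fine_cvgP; split.
  near=> n.
  (* Only finiteness is extracted here; a negative radius makes the condition near 0 vacuous. *)
  by case: (integral_near0_le (r := -1) (e := 0) (nu1 n) cf fM) => // x xr;
    have := normr_ge0 x; lra.
apply/cvgrPdist_le => e e0.
have /cvgrPdist_le/(_ (e / 2)) : f x @[x --> 0] --> f 0 by exact: cf.
have e20 : 0 < e / 2 by rewrite divr_gt0.
move=> /(_ e20)/nbhs_ballP[r r0 rf].
have fr x : `|x| <= r / 2 -> `|f x - f 0| <= e / 2.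
  move=> xr; rewrite distrC; apply: rf; rewrite -ball_normE/= sub0r normrN.
  by apply: le_lt_trans xr _; rewrite ltr_pdivrMr// mulr_natr mulr2n ltrDl.
have r20 : 0 < r / 2 by rewrite divr_gt0.
(* The added 1 keeps the divisor positive when [M = 0], and [2 M e / (4 (M + 1)) <= e / 2]. *)
have M1 : 0 < 4 * (M + 1) by lra.
have /cvgrPdist_le/(_ (e / (4 * (M + 1)))) := cvg0 (r / 2) r20.
rewrite divr_gt0// => /(_ isT) near0; near=> n.
have [_] := integral_near0_le (nu1 n) cf fM (ltW e20) fr.
rewrite distrC => /le_trans; apply.
rewrite [leRHS](splitr e) lerD2l.
have : `|0 - fine (nu n [set x | r / 2 < `|x| ])| <= e / (4 * (M + 1)) by near: n.
rewrite sub0r normrN => /(le_trans (ler_norm _)) pe.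
apply: (@le_trans _ _ (2 * M * (e / (4 * (M + 1))))).
  by rewrite ler_wpM2l// mulr_ge0.
rewrite mulrA ler_pdivrMr//; nra.
Unshelve. all: by end_near.
Qed.

End weak_convergence.

(** * Survival and the maximal occupation number *)

Section moments_bounded.
Context (dT : measure_display) (T : measurableType dT) (R : realType).
Variables (P : probability T R) (Q : probability nat R).
Hypothesis Q1 : natE Q id = 1%E.

Lemma moments_bounded d a : (3 <= d)%N ->
  (forall k, (k <= a)%N -> (natE Q (fun l => l ^ k)%N < +oo)%E) ->
  exists2 D : R, 0 <= D & forall b, (0 < b <= a)%N -> moment_bound P Q d b (fun=> D).
Proof.
move=> d3; have [s [s1 ps] [G sG]] := unit_walk_sup_summable R d3.
have p0 := walk_law_ge0 R (unit_steps d).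
have G0 : 0 <= G by have := sG 0%N; rewrite big_ord0.
elim: a => [|a IH] Qa.
  by exists 0 => // b /andP[b0]; rewrite leqn0 => /eqP b00; rewrite b00 in b0.
have [D D0 HD] := IH (fun k ka => Qa k (leqW ka)).
have [C [C0 _ HC]] := moment_recursion Q1 (ltn0Sn a) D0 HD (Qa _ (leqnn _)) ps.
have CG0 : 0 <= 1 + C * G by rewrite addr_ge0// mulr_ge0.
exists (D + (1 + C * G)); first exact: addr_ge0.
move=> b /andP[b0]; rewrite leq_eqVlt => /predU1P[->|ba] n xi step drv x.
- apply: le_trans (HC n xi step drv x) _; rewrite lee_fin ler_wpM2r//.
  rewrite -[leLHS]add0r lerD// lerD2l ler_wpM2l//.
  apply: le_trans (sG n.+1); rewrite big_ord_recl lerDr.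
  exact: le_trans (p0 0%N 0) (ps _ _).
- have := HD b; rewrite b0 -ltnS ba => /(_ isT n xi step drv x) /le_trans; apply.
  by rewrite lee_fin ler_wpM2r// lerDl.
Qed.

End moments_bounded.

Section survival_probability.
Context (dT : measure_display) (T : measurableType dT) (R : realType).
Variables (P : probability T R) (Q : probability nat R).
Hypothesis Q1 : natE Q id = 1%E.
Local Notation dmeas := (discretely_measurable (@measurable _ T)).

Lemma natE_size_generation d n (xi : label -> T -> nat) (step : label -> T -> 'rV[int]_d) :
  brw_driver xi step P Q -> natE P (fun w => size (generation (xi^~ w) n)) = 1%E.
Proof.
elim: n xi step => [|n IH] xi step drv; first by rewrite natE_cst.
pose Y i w := size (generation ((shift i xi)^~ w) n).
have SY i : depends xi step (subtree i) (Y i).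
  apply: discretely_measurable_comp.
  exact (@depends_shift_generation _ _ _ xi step i n).
have mY i : dmeas (Y i) by exact (depends_measurable drv (SY i)).
have mxi := brw_measurable_xi drv [::].
rewrite (eq_natE P (Y := fun w => partial_sum Y (xi [::] w) w)); last first.
  by move=> w; rewrite size_generation_first.
rewrite natE_random_index//; last 2 first.
- by move=> l; exact: discretely_measurable_partial_sum.
- move=> l; exact (independent_root_partial_sum drv l SY).
rewrite -Q1 -(natE_xi drv [::] id) (natE_countable P id mxi).
apply: eq_eseriesr => l _; congr (_ * _)%E.
rewrite /partial_sum (natE_sum P (index_enum 'I_l) (X := fun i : 'I_l => Y i))//.
rewrite (eq_bigr (fun=> 1%E)); last by move=> i _; exact: IH (brw_driver_shift i drv).
by rewrite sumEFin sumr_const card_ord.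
Qed.

(** In dimension 0 all particles share one site, so the moment bounds for [U] become
    bounds for the size of the population. *)
Lemma brw_driver_forget_position d (xi : label -> T -> nat) (step : label -> T -> 'rV[int]_d) :
  brw_driver xi step P Q -> brw_driver xi (fun _ _ => 0 : 'rV[int]_0) P Q.
Proof.
case=> mxi mstep lxi lstep ind.
have z0 (z : 'rV[int]_0) : z = 0 by apply/matrixP => i [].
pose lift (C : set 'rV[int]_0) : set 'rV[int]_d := [set _ | C 0].
have liftE u C : (fun=> 0 : 'rV[int]_0) @^-1` C = step u @^-1` lift C by [].
split=> // [u C|u z|B C J].
- by rewrite (liftE u).
- rewrite big_ord0 muln0 add0n invr1 (z0 z).
  rewrite (_ : _ @^-1` _ = setT) ?probability_setT//; exact/seteqP.
rewrite (_ : (fun i : label + label => _) = (fun i => match i with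
  | inl u => xi u @^-1` B u | inr u => step u @^-1` lift (C u) end)).
  exact: ind.
by apply/funext => -[].
Qed.

(** With mean 1 and second moment at most [1 + C n <= m], the inequality
    [2 m Z <= Z^2 + m^2 1_(Z > 0)] gives [2 m <= m + m^2 P(Z > 0)]. *)
Lemma survival_ge d (xi : label -> T -> nat) (step : label -> T -> 'rV[int]_d) :
  brw_driver xi step P Q -> (natE Q (fun l => l ^ 2)%N < +oo)%E ->
  exists2 c : R, 0 < c & forall n, (0 < n)%N -> (((c * n%:R)^-1)%:E <= P (survival xi n))%E.
Proof.
move=> drv Q2; have drv0 := brw_driver_forget_position drv.
have ps n x : walk_law R (unit_steps 0) n x <= 1 by exact: walk_law_le1.
have M0 : forall b, (0 < b < 1)%N -> moment_bound P Q 0 b (fun=> 1 : R) by case.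
have Q1' : (natE Q (fun l => l ^ 1)%N < +oo)%E by rewrite [X in (X < _)%E]Q1 ltry.
(* In dimension 0 the suprema sum to [n]; [C1 = 0] keeps the first moments bounded by 1, and the
   second moment then grows only linearly. *)
have [C1 [_ /(_ erefl) C10 H1]] := moment_recursion Q1 (ltn0Sn 0) ler01 M0 Q1' ps.
have M1 : forall b, (0 < b < 2)%N -> moment_bound P Q 0 b (fun=> 1 : R).
  case=> [|[|]]// _ n xi' step' drv' x.
  by have := H1 n xi' step' drv' x; rewrite C10 mul0r addr0.
have [C [C0 _ H2]] := moment_recursion Q1 (ltn0Sn 1) ler01 M1 Q2 ps.
pose Z n w := size (generation (xi^~ w) n).
have mZ n : dmeas (Z n).
  exact: (discretely_measurable_comp size (@measurable_generation _ _ _ _ _ _ _ _ n drv)).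
have Z2 n : (natE P (fun w => Z n w ^ 2)%N <= (1 + C * n%:R)%:E)%E.
  have := H2 n xi _ drv0 0; rewrite sumr_const card_ord -mulr_natr mul1r.
  rewrite (eq_natE P (Y := fun w => Z n w ^ 2)%N); last first.
    move=> w; congr (_ ^ _)%N; rewrite /U (eq_count (a2 := predT)) ?count_predT// => u.
    by apply/eqP/matrixP => i [].
  move=> /le_trans; apply; rewrite lee_fin ler_piMr// addr_ge0// mulr_ge0//.
pose c := (Num.trunc C).+2.
have cC : 1 + C <= c%:R.
  have := truncnS_gt C; rewrite /c -[in leRHS]natr1; lra.
exists c%:R; first by rewrite ltr0n.
move=> n n0; pose m := (c * n)%N.
have m0 : (0 < m)%N by rewrite muln_gt0.
have mS : measurable (survival xi n).
  rewrite (_ : survival xi n = Z n @^-1` [set k | (0 < k)%N]); first exact: mZ.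
  by apply/seteqP; split=> w; rewrite /survival /Z /= -size_eq0 lt0n.
have fS : P (survival xi n) \is a fin_num by exact: fin_num_measure.
have mX (f : nat -> nat) : dmeas (f \o Z n) by exact: discretely_measurable_comp.
have mI : dmeas (fun w => (w \in survival xi n) : nat).
  apply: (discretely_measurable_comp nat_of_bool).
  exact: (discretely_measurable_mem (sigma_algebra_measurable T)).
have : ((2 * m)%:R%:E <= natE P (fun w => Z n w ^ 2)%N + (m ^ 2)%:R%:E * P (survival xi n))%E.
  rewrite -[leLHS]mule1 -(natE_size_generation n drv) -(natE_indic _ mS) -!natEZ//;
    last exact: mZ.
  have mI2 : dmeas (fun w => (m ^ 2 * (w \in survival xi n))%N).
    exact: (discretely_measurable_comp (fun k => m ^ 2 * k)%N mI).
  rewrite -natED//; last exact: (mX (fun k => k ^ 2)%N).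
  (* [2 m Z <= Z^2 + m^2 1_(Z > 0)] *)
  apply: natE_le.
  - exact: (mX (fun k => 2 * m * k)%N).
  - apply: (discretely_measurable2 (sigma_algebra_measurable T) addn) => //.
    exact: (mX (fun k => k ^ 2)%N).
  move=> w; rewrite -/(Z n w); have [Z0|Z0] := posnP (Z n w); first by rewrite Z0 muln0.
  rewrite mem_set ?muln1; last by rewrite /survival/= -size_eq0 -lt0n.
  by rewrite -mulnA (mulnC m); exact: nat_Cauchy.
move=> /le_trans/(_ (leeD2r _ (Z2 n))).
rewrite -(fineK fS) -EFinM -EFinD !lee_fin; set p := fine _ => H.
have mR : 0 < m%:R :> R by rewrite ltr0n.
have CM : 1 + C * n%:R <= m%:R.
  rewrite /m natrM; apply: le_trans (ler_wpM2r _ cC); last by [].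
  by rewrite mulrDl mul1r lerD2r (ler_nat _ 1).
rewrite -natrM -/m -div1r ler_pdivrMr//.
rewrite natrM natrX in H; nra.
Qed.

End survival_probability.

(** * The tail of the maximum *)

Section max_tail.
Context (dT : measure_display) (T : measurableType dT) (R : realType).
Variables (P : probability T R) (Q : probability nat R) (d : nat).
Variables (xi : label -> T -> nat) (step : label -> T -> 'rV[int]_d).
Hypothesis drv : brw_driver xi step P Q.
Local Notation dmeas := (discretely_measurable (@measurable _ T)).
Local Notation natE := (natE P).

Lemma natE_markov (X : T -> nat) (a : R) (A : set T) : dmeas X -> measurable A ->
  0 <= a -> (forall w, A w -> a <= (X w)%:R) -> (a%:E * P A <= natE X)%E.
Proof.
move=> mX mA a0 aX.
have mXR : measurable_fun setT (fun w => ((X w)%:R : R)%:E).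
  by move=> _ Y _; rewrite setTI; exact: (mX [set n | Y (n%:R)%:E]).
rewrite -integral_cst//.
apply: (@le_trans _ _ (\int[P]_(w in A) ((X w)%:R : R)%:E)%E).
  by apply: ge0_le_integral => //; exact: measurable_funTS.
rewrite -[leRHS]/(\int[P]_(w in setT) ((X w)%:R : R)%:E)%E.
by apply: ge0_subset_integral.
Qed.

(** The maximum is a function of the list of positions, which has countably many values. *)
Lemma measurable_V n : dmeas (V R xi step n).
Proof.
have sT := sigma_algebra_measurable T.
pose positions w := [seq position (step^~ w) u | u <- generation (xi^~ w) n].
pose F (l : seq 'rV[int]_d) : R := sup (range (fun x => (count_mem x l)%:R)).
have -> : V R xi step n = F \o positions.
  apply/funext => w; rewrite /V /F /=.
  have UE x : U xi step n x w = count_mem x (positions w) by rewrite /U /positions count_map.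
  by under eq_fun do rewrite UE.
apply: discretely_measurable_comp.
apply: (discretely_measurable_bind sT
  (F := fun g w => [seq position (step^~ w) u | u <- g])
  (@measurable_generation _ _ _ _ _ _ _ _ n drv)).
elim=> [|u g IHg]; first exact: (discretely_measurable_cst sT).
apply: (discretely_measurable2 sT (fun (y : 'rV[int]_d) l => y :: l)) => //.
apply: discretely_measurable_position => // v _.
exact: (brw_measurable_step drv).
Qed.

Lemma V_ge0 n w : 0 <= V R xi step n w.
Proof. by have [x -> _] := V_max R xi step n w. Qed.

(** Union bound over all sites, enumerated by their codes; a number that is no code gets the empty
    event. The pointwise factor [p_n(x)] makes the sum over infinitely many sites finite. *)
Lemma V_tail (a : nat) (D t : R) n : (0 < a)%N -> 0 <= D -> 0 < t ->
  moment_bound P Q d a (fun=> D) ->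
  (P [set w | t < V R xi step n w]%R <= (D / t ^+ a)%:E)%E.
Proof.
move=> a0 D0 t0 HD.
pose A (x : 'rV[int]_d) := [set w | (t < (U xi step n x w)%:R)%R].
pose B m := oapp A set0 (@choice.pickle_inv 'rV[int]_d m).
have mA x : measurable (A x).
  exact: (measurable_U n x drv [set k | (t < k%:R)%R]).
have mB m : measurable (B m) by rewrite /B; case: choice.pickle_inv => /=.
have PA x : (P (A x) <= (D / t ^+ a * walk_law R (unit_steps d) n x)%:E)%E.
  have ta : 0 < t ^+ a by rewrite exprn_gt0.
  have fA : P (A x) \is a fin_num by exact: fin_num_measure.
  have : ((t ^+ a)%:E * P (A x) <= natE (fun w => U xi step n x w ^ a)%N)%E.
    apply: natE_markov => //; [|exact: ltW|].
      apply: (discretely_measurable_comp (fun k => k ^ a)%N).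
      exact: measurable_U drv.
    by move=> w; rewrite /A /= => /ltW tU; rewrite natrX lerXn2r ?nnegrE ?ler0n ?(ltW t0).
  move=> /le_trans/(_ (HD n xi step drv x)).
  rewrite -(fineK fA) -EFinM !lee_fin => H.
  by rewrite mulrAC ler_pdivlMr// mulrC.
apply: (@le_trans _ _ (\sum_(0 <= m <oo) P (B m))%E).
  apply: measure_sigma_subadditive => //.
    exact: (measurable_V n [set v | t < v]).
  move=> w /=; have [x -> _] := V_max R xi step n w => tU.
  by exists (choice.pickle x) => //; rewrite /B choice.pickleK_inv.
apply: lime_le; first exact: is_cvg_nneseries.
apply: nearW => N.
apply: (@le_trans _ _ (\sum_(0 <= m < N)
    (D / t ^+ a *
     oapp (walk_law R (unit_steps d) n) 0 (@choice.pickle_inv 'rV[int]_d m))%:E)%E).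
  apply: lee_sum => m _; rewrite /B; case: choice.pickle_inv => [x|]/=; first exact: PA.
  by rewrite measure0 mulr0.
rewrite sumEFin lee_fin -mulr_sumr -big_pmap ler_piMr//.
  by rewrite divr_ge0// exprn_ge0// ltW.
apply: sum_walk_law_le1 => //; apply: (pmap_uniq choice.pickle_invK).
exact: iota_uniq.
Qed.

Lemma cond_V_tail (a n : nat) (D c r f : R) : (0 < a)%N -> 0 <= D -> 0 < r -> 0 < f ->
  0 < c -> (0 < n)%N -> (((c * n%:R)^-1)%:E <= P (survival xi n))%E ->
  moment_bound P Q d a (fun=> D) ->
  (cond_distribution P (survival xi n) (fun w => V R xi step n w / f)%R [set x | r < `|x|]%R
   <= (c * n%:R * (D / (r * f) ^+ a))%:E)%E.
Proof.
move=> a0 D0 r0 f0 c0 n0 PS HD.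
have cn0 : 0 < c * n%:R by rewrite mulr_gt0// ltr0n.
have mS : measurable (survival xi n).
  exact: (@measurable_generation _ _ _ _ _ _ _ _ n drv [set g | g != [::]]).
have fS : P (survival xi n) \is a fin_num by exact: fin_num_measure.
rewrite /cond_distribution EFinM; apply: lee_pmul => //.
- by rewrite lee_fin invr_ge0 fine_ge0.
- move: PS; rewrite -[X in (_ <= X)%E](fineK fS) !lee_fin => PS.
  rewrite -[leRHS]invrK lef_pV2// posrE ?invr_gt0//.
  by apply: lt_le_trans PS; rewrite invr_gt0.
apply: le_trans (@V_tail a D (r * f) n a0 D0 (mulr_gt0 r0 f0) HD).
have mV (B : set R) : measurable (V R xi step n @^-1` B) by exact: measurable_V.
apply: le_measure; rewrite ?inE.
- by apply: measurableI => //; exact: (mV [set v | r < `|v / f|]).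
- exact: (mV [set v | r * f < v]).
move=> w [/= + _]; rewrite ger0_norm ?divr_ge0 ?V_ge0// ?ltW//.
by rewrite ltr_pdivlMr.
Qed.

End max_tail.

Theorem theorem2 (dT : measure_display) (T : measurableType dT) (R : realType)
    (P : probability T R) (Q : probability nat R) (d : nat)
    (xi : label -> T -> nat) (step : label -> T -> 'rV[int]_d) :
  brw_driver xi step P Q ->
  ('E_Q[fun l : nat => (l%:R : R)%R] = 1)%E ->
  (0 < 'V_Q[fun l : nat => (l%:R : R)%R])%E ->
  ('V_Q[fun l : nat => (l%:R : R)%R] < +oo)%E ->
  (3 <= d)%N ->
  (forall alpha : nat, (2 <= alpha)%N ->
     ('E_Q[fun l : nat => (l%:R ^+ alpha : R)%R] < +oo)%E ->
     bigO_P P (V R xi step) (fun n => n%:R `^ (alpha%:R^-1)) (survival xi)) /\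
  ((forall k : nat, ('E_Q[fun l : nat => (l%:R ^+ k : R)%R] < +oo)%E) ->
   forall eps : R, 0 < eps ->
     littleo_P P (V R xi step) (fun n => n%:R `^ eps) (survival xi)).
Proof.
move=> drv E1 _ _ d3.
have EE k : ('E_Q[fun l : nat => (l%:R ^+ k : R)%R] = natE Q (fun l => l ^ k)%N)%E.
  by rewrite expectation.unlock; apply: eq_integral => l _; rewrite natrX.
have Q1 : natE Q id = 1%E by rewrite -E1 expectation.unlock.
have bounds a : (2 <= a)%N -> ('E_Q[fun l : nat => (l%:R ^+ a : R)%R] < +oo)%E ->
    exists2 D : R, 0 <= D & moment_bound P Q d a (fun=> D) /\
    exists2 c : R, 0 < c & forall n, (0 < n)%N ->
      (((c * n%:R)^-1)%:E <= P (survival xi n))%E.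
  move=> a2; rewrite EE => Qa.
  have Qk k : (k <= a)%N -> (natE Q (fun l => l ^ k)%N < +oo)%E.
    move=> ka; apply: (@le_lt_trans _ _ (natE Q (fun l => 1 + l ^ a)%N)).
      apply: natE_le => // -[|l]; last by rewrite (leq_trans (leq_pexp2l _ ka))// leq_addl.
      by apply: leq_trans (leq_addr _ _); case: (k) => // k'; rewrite exp0n.
    by rewrite natED// natE_cst lte_add_pinfty// ltry.
  have [D D0 HD] := moments_bounded P Q1 d3 Qk.
  exists D => //; split; first by apply: HD; rewrite leqnn (ltn_trans _ a2).
  exact: survival_ge drv (Qk 2%N a2).
split=> [a a2 Qa e e0|Qa eps eps0].
- have [D D0 [HD [c c0 PS]]] := bounds a a2 Qa.
  have a0 : (0 < a)%N by exact: ltn_trans a2.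
  (* Then [c D <= e M], and [M >= 1] gives [M <= M^a]. *)
  pose M := 1 + c * D / e.
  have M1 : 1 <= M by rewrite lerDl divr_ge0 ?mulr_ge0// ltW.
  have M0 : 0 < M by exact: lt_le_trans M1.
  exists [set x | `|x| <= M].
    rewrite (_ : [set _ | _] = `[- M, M]%classic); first exact: segment_compact.
    by apply/seteqP; split=> x; rewrite /= in_itv/= ler_norml.
  move=> n n0; rewrite (_ : ~` _ = [set x | M < `|x|]); last first.
    by apply/seteqP; split=> x /=; rewrite ltNge => /negP.
  have nR : 0 < n%:R :> R by rewrite ltr0n.
  apply: le_trans (cond_V_tail drv a0 D0 M0 (powR_gt0 _ nR) c0 n0 (PS n n0) HD) _.
  rewrite lee_fin exprMn -[_ `^ _ ^+ a]powR_mulrn ?powR_ge0// -powRrM mulVf ?pnatr_eq0 -?lt0n//.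
  rewrite powRr1 ?(ltW nR)// invfM.
  have -> : c * n%:R * (D * (M ^- a / n%:R)) = c * D / M ^+ a.
    by field; rewrite !gt_eqF// exprn_gt0.
  rewrite ler_pdivrMr ?exprn_gt0//.
  apply: (@le_trans _ _ (e * M)).
    by rewrite /M mulrDr mulr1 mulrCA divff ?gt_eqF// mulr1 lerDr ltW.
  by rewrite ler_wpM2l ?(ltW e0)// -[leLHS]expr1 ler_weXn2l.
(* With [eps * a >= 2] the factor [n] lost to conditioning is beaten: the conditional tail is of
   order [n / n^2]. *)
have [a a2 aeps] : exists2 a, (2 <= a)%N & 2 <= eps * a%:R.
  exists (Num.trunc (2 / eps)).+2 => //.
  rewrite mulrC -ler_pdivrMr//; have := truncnS_gt (2 / eps).
  by rewrite -[in leRHS]natr1 => ?; lra.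
have a0 : (0 < a)%N by exact: ltn_trans a2.
have [D D0 [HD [c c0 PS]]] := bounds a a2 (Qa a).
apply: cvg_weakly_dirac0.
- by move=> n; exact: (@measurable_generation _ _ _ _ _ _ _ _ n drv [set g | g != [::]]).
- by move=> n _ B _; rewrite setTI; exact: (measurable_V drv n [set v | B (v / n%:R `^ eps)]).
(* The lower bound on survival starts at generation 1; generation 0 is never empty. *)
- case=> [|n]; first by rewrite (_ : survival xi 0 = setT) ?probability_setT//; apply/seteqP.
  by apply: lt_le_trans (PS n.+1 isT); rewrite lte_fin invr_gt0 mulr_gt0// ltr0n.
move=> r r0; apply/cvgrPdist_le => e e0.
have ra : 0 < r ^+ a by rewrite exprn_gt0.
near=> n.
have n1 : (1 : R) <= n%:R by near: n; exact: nbhs_infty_ger.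
have nB : c * D / (r ^+ a * e) <= n%:R by near: n; exact: nbhs_infty_ger.
have nR : 0 < n%:R :> R by exact: lt_le_trans n1.
have n0 : (0 < n)%N by rewrite -(ltr0n R).
have := cond_V_tail drv a0 D0 r0 (powR_gt0 eps nR) c0 n0 (PS n n0) HD.
set p := cond_distribution _ _ _ _ => pD.
have p0 : (0 <= p)%E by rewrite mule_ge0// lee_fin invr_ge0 fine_ge0.
have fp : p \is a fin_num by rewrite ge0_fin_numE// (le_lt_trans pD)// ltry.
rewrite sub0r normrN ger0_norm ?fine_ge0//.
move: pD; rewrite -{1}(fineK fp) lee_fin => /le_trans; apply.
rewrite exprMn -[_ `^ eps ^+ a]powR_mulrn ?powR_ge0// -powRrM.
have n2 : n%:R ^+ 2 <= n%:R `^ (eps * a%:R).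
  by rewrite -powR_mulrn ?(ltW nR)// ler_powR.
apply: (@le_trans _ _ (c * n%:R * (D / (r ^+ a * n%:R ^+ 2)))).
  rewrite ler_wpM2l ?mulr_ge0 ?(ltW c0)// ler_wpM2l// lef_pV2 ?posrE;
    rewrite ?mulr_gt0 ?exprn_gt0 ?powR_gt0//.
  by rewrite ler_pM2l.
have -> : c * n%:R * (D / (r ^+ a * n%:R ^+ 2)) = c * D / (r ^+ a * e) * (e / n%:R).
  by field; rewrite !gt_eqF.
rewrite mulrA ler_pdivrMr// mulrC ler_pM2l//.
Unshelve. all: by end_near.
Qed.
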